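(* Let $\widetilde R_q(z)$ and $\widetilde R_{r,s}(z)$ be the normalized one- and two-parameter affine $R$-matrices of type $B_n$ (resp. $C_n$, $D_n$), with $q=r^{1/2}s^{-1/2}$, and $(\psi_i)_{i=1}^N$ the corresponding scalars. There is a unique Hopf algebra isomorphism $\widehat\Psi'\colon\widetilde U(\widetilde R_{r,s}(z))\to\widetilde U(\widetilde R_q(z))_\zeta$ mapping $\gamma^{1/2}\mapsto\gamma^{1/2}$, $(\gamma')^{1/2}\mapsto(\gamma')^{1/2}$, and $\ell_{ij}^\pm[\mp m]\mapsto\psi_i^{-1}\psi_j\ell_{ij}^\pm[\mp m]$ for all $1\le i,j\le N$, $m\in\mathbb Z_{\ge0}$.
   Context: $\mathbb K$ is an algebraically closed field, $r,s\in\mathbb K$ are transcendental with $rs^{-1}$ not a root of unity; fractional powers of $r,s$ refer to fixed compatible systems of roots; $q=r^{1/2}s^{-1/2}$. Type $B_n$: $N=2n+1$, $i'=2n+2-i$, $v=q^{-2}$, $\xi=q^{-4n+2}$. Type $C_n$: $N=2n$, $i'=2n+1-i$, $v=q^{-1}$, $\xi=q^{-2-2n}$. Type $D_n$ ($n\ge3$): $N=2n$, $i'=2n+1-i$, $v=q^{-1}$, $\xi=q^{2-2n}$. $P$ is the weight lattice; $\varepsilon_1,\dots,\varepsilon_n$ the standard basis ($\alpha_i=\varepsilon_i-\varepsilon_{i+1}$ for $i<n$, $\alpha_n=\varepsilon_n$, $2\varepsilon_n$, $\varepsilon_{n-1}+\varepsilon_n$ in types $B,C,D$), $\varepsilon_{i'}=-\varepsilon_i$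 for $i\le n$, and $\varepsilon_{n+1}=0$ in type $B_n$. $E_{ij}$ are matrix units, $\tau$ the flip on $\mathbb K^N\otimes\mathbb K^N$. Unless indicated, indices run over $1,\dots,N$. Finite matrices: type $B_n$: $\hat R_q=q^{-2}\sum_{i\ne n+1}E_{ii}\otimes E_{ii}+E_{n+1,n+1}\otimes E_{n+1,n+1}+q^2\sum_{i\ne n+1}E_{ii'}\otimes E_{i'i}+\sum_{j\ne i,i'}E_{ij}\otimes E_{ji}+(q^2-q^{-2})\sum_{i=1}^n(q^{4(n-i)+2}-1)E_{i'i'}\otimes E_{ii}+(q^{-2}-q^2)\sum_{i>j,\,j\ne i'}E_{ii}\otimes E_{jj}+(q^2-q^{-2})\sum_{i<j,\,j\ne i'}t_it_j^{-1}E_{i'j}\otimes E_{ij'}$, $t_i=q^{2(n-i)+1}$ for $i\le n$, $t_{n+1}=q$, $t_i=q^{2(n+1-i)+1}$ for $i>n+1$. Type $C_n$: $\hat R_q=q^{-1}\sum_iE_{ii}\otimes E_{ii}+q\sum_iE_{ii'}\otimes E_{i'i}+\sum_{j\ne i,i'}E_{ij}\otimes E_{ji}+(q^{-1}-q)\sum_{i=1}^n(q^{2(n+1-i)}+1)E_{i'i'}\otimes E_{ii}+(q^{-1}-q)\sum_{i>j,\,j\ne i'}E_{ii}\otimes E_{jj}+(q-q^{-1})\sum_{i<j,\,j\ne i'}t_it_j^{-1}E_{i'j}\otimes E_{ij'}$, $t_i=q^{n+1-i}$ for $i\le n$, $t_i=-q^{n-i}$ for $i>n$. Type $D_n$: the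 same expression as for $C_n$ but with $(q^{-1}-q)\sum_{i=1}^n(1-q^{2(n-i)})E_{i'i'}\otimes E_{ii}$ as the fourth term and $t_i=q^{n-i}$ for $i\le n$, $t_i=q^{n+1-i}$ for $i>n$. $\zeta(\sum\lambda_i\varepsilon_i,\sum\mu_j\varepsilon_j)=\kappa^{\sum_{1\le i<j\le n}(\lambda_i\mu_j-\lambda_j\mu_i)}$ on $P$, with $\kappa=(rs)^{1/2}$ in type $B_n$, $\kappa=(rs)^{1/4}$ in types $C_n,D_n$. Scalars: type $B_n$: $\psi_i=(rs)^{(n-i)/2}$ ($i\le n$), $\psi_{n+1}=1$, $\psi_i=(rs)^{(i-n-2)/2}$ ($i\ge n+2$); type $C_n$: $\psi_i=(rs)^{(n-i)/4}$ ($i\le n$), $(rs)^{(i-n-1)/4}$ ($i>n$); type $D_n$: $\psi_i=(rs)^{(n-i)/4}$ ($i\le n$), $(rs)^{(i-n-3)/4}$ ($i>n$). $\hat R_{r,s}=S^{-1}D\hat R_qD^{-1}S$ with $D=\sum\zeta(\varepsilon_j,\varepsilon_i)E_{ii}\otimes E_{jj}$, $S=\sum\psi_i\psi_jE_{ii}\otimes E_{jj}$. Affine matrices: for $\hat R\in\{\hat R_q,\hat R_{r,s}\}$ put $\hat R(z)=vz(z-1)\hat R^{-1}+(1-\xi)(1-v^2)z\,\mathrm{Id}-\xi v(z-1)\hat R$; $R_q(z)=\hat R_q(z)\circ\tau$, $R_{r,s}(z)=\hat R_{r,s}(z)\circ\tau$; $\widetilde R_q(z)=f(z)R_q(z)$,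 $\widetilde R_{r,s}(z)=f(z)R_{r,s}(z)$, where $f(z)=\prod_{k\ge0}\frac{(1-z\xi^{2k})(1-zv^2\xi^{2k+1})(1-zv^{-2}\xi^{2k+1})(1-z\xi^{2k+2})}{(1-z\xi^{2k-1})(1-z\xi^{2k+1})(1-zv^{-2}\xi^{2k})(1-zv^2\xi^{2k})}$ as a formal power series in $z$, i.e. the unique series with $f(0)=1$ and $f(z)f(z\xi)=\frac1{(1-zv^2)(1-zv^{-2})(1-z\xi)(1-z\xi^{-1})}$. For $R(z)$ satisfying $R_{12}(z)R_{13}(zw)R_{23}(w)=R_{23}(w)R_{13}(zw)R_{12}(z)$, $U(R(z))$ is the $\mathbb K$-algebra generated by central invertible $\gamma^{\pm1/2},(\gamma')^{\pm1/2}$, by $\ell_{ij}^\pm[\mp m]$ ($1\le i,j\le N$, $m\ge0$) and $(\ell_{ii}^\pm[0])^{-1}$, with $\ell_{ij}^+[0]=\ell_{ji}^-[0]=0$ for $i<j$, $\ell_{ii}^\pm[0](\ell_{ii}^\pm[0])^{-1}=(\ell_{ii}^\pm[0])^{-1}\ell_{ii}^\pm[0]=1$, $R(z/w)L_1^\pm(z)L_2^\pm(w)=L_2^\pm(w)L_1^\pm(z)R(z/w)$, $R(z\gamma(\gamma\gamma')^{1/2}/w)L_1^+(z)L_2^-(w)=L_2^-(w)L_1^+(z)R(z\gamma'(\gamma\gamma')^{1/2}/w)$, where $R$ is expanded as a power series in its argument, $\ell_{ij}^\pm(w)=\sum_{m\ge0}\ell_{ij}^\pm[\mp m]w^{\pm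 m}$, $L_1^\pm(w)=\sum E_{ij}\otimes1\otimes\ell_{ij}^\pm(w)$, $L_2^\pm(w)=\sum1\otimes E_{ij}\otimes\ell_{ij}^\pm(w)$. It is a Hopf algebra with $\gamma^{1/2},(\gamma')^{1/2}$ grouplike, $\Delta(\ell_{ij}^+(z))=\sum_k\ell_{ik}^+(z(1\otimes\gamma^{3/2}))\otimes\ell_{kj}^+(z(\gamma^{1/2}\otimes1))$, $\Delta(\ell_{ij}^-(z))=\sum_k\ell_{ik}^-(z(1\otimes(\gamma')^{-1/2}))\otimes\ell_{kj}^-(z((\gamma')^{-3/2}\otimes1))$, $\epsilon(\ell_{ij}^\pm(z))=\delta_{ij}$, $S(L^+(z))=L^+(z\gamma^{-2})^{-1}$, $S(L^-(z))=L^-(z(\gamma')^2)^{-1}$. Put $A^{\mathsf t'}=(a_{j'i'})$ for $A=(a_{ij})$. $C_q=\mathrm{diag}(c_i)$: type $B_n$: $c_i=q^{2\rho_i}$, $(\rho_i)=(n-\frac12,\dots,\frac12,\frac12,-\frac12,\dots,-n+\frac12)$; type $C_n$: $c_i=\sigma_iq^{\rho_i}$, $(\rho_i)=(n,\dots,1,-1,\dots,-n)$, $\sigma_i=1$ for $i\le n$, $-1$ for $i>n$; type $D_n$: $c_i=q^{\rho_i}$, $(\rho_i)=(n-1,\dots,1,0,0,-1,\dots,-n+1)$. $C_{r,s}=\mathrm{diag}(\psi_i^{-1}\psi_{i'}^{-1}c_i)$. $\widetilde U(\widetilde R_q(z))$ (resp. $\widetilde U(\widetilde R_{r,s}(z))$)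 is the quotient of $U(\widetilde R_q(z))$ (resp. $U(\widetilde R_{r,s}(z))$) by $L^\pm(z)CL^\pm(z\xi)^{\mathsf t'}C^{-1}=I$ with $C=C_q$ (resp. $C_{r,s}$) and, in type $B_n$, by $\ell_{n+1,n+1}^\pm[0]=1$. $\widetilde U(\widetilde R_q(z))$ is $P$-bigraded by $\deg\gamma^{1/2}=\deg(\gamma')^{1/2}=(0,0)$, $\deg\ell_{ij}^\pm[\mp m]=(-\varepsilon_i,\varepsilon_j)$; $\widetilde U(\widetilde R_q(z))_\zeta$ is the same vector space with product $a\circ b=\zeta(\alpha,\alpha')\zeta(\beta,\beta')^{-1}ab$ for $\deg a=(\alpha,\beta)$, $\deg b=(\alpha',\beta')$, and the same coproduct, counit and antipode. *)

(* Defs.v *)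
From HB Require Import structures.
From mathcomp Require Import all_boot all_order all_algebra.
From mathcomp Require Import finmap boolp monalg mxtens.

Set Implicit Arguments.
Unset Strict Implicit.
Unset Printing Implicit Defensive.

Import Order.TTheory GRing.Theory Num.Theory.
Local Open Scope quotient_scope.
Local Open Scope ring_scope.

Section QuotientModule.
Variables (K : fieldType) (V : lmodType K) (I : submodClosed V).

Definition submod_pred : {pred V} := fun x => x \in I.
Lemma submod_pred_closed : zmod_closed submod_pred.
Proof.
split=> [|x y xI yI]; first exact: (rpred0 I).
by rewrite -scaleN1r; apply: (rpredD xI); apply: rpredZ.
Qed.
HB.instance Definition _ := GRing.isZmodClosed.Build V submod_pred
  submod_pred_closed.

Definition lquot : Type := Quotient.quot submod_pred.
HB.instance Definition _ := GRing.Zmodule.on lquot.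
HB.instance Definition _ := EqQuotient.on lquot.

Definition lpi (x : V) : lquot := \pi_(Quotient.quot submod_pred) x.

Lemma lpi_is_zmod_morphism : zmod_morphism lpi.
Proof. exact: (raddfB (\pi_(Quotient.quot submod_pred))). Qed.
HB.instance Definition _ :=
  GRing.isZmodMorphism.Build V lquot lpi lpi_is_zmod_morphism.

Lemma lpi_eqP x y : reflect (lpi x = lpi y) (x - y \in I).
Proof.
have -> : (x - y \in I) = (x == y %[mod Quotient.quot submod_pred]).
  by rewrite -Quotient.idealrBE.
exact: eqP.
Qed.

Lemma lpi_eq0 x : (lpi x == 0) = (x \in I).
Proof. by rewrite -(raddf0 lpi) -[in RHS](subr0 x); apply/eqP/lpi_eqP. Qed.

Lemma lpi_repr (x : lquot) : lpi (repr x) = x.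
Proof. exact: reprK. Qed.

Definition lquot_scale (c : K) (x : lquot) : lquot := lpi (c *: repr x).

Lemma lquot_scaleE c x : lquot_scale c (lpi x) = lpi (c *: x).
Proof. by apply/lpi_eqP; rewrite -scalerBr rpredZ//; apply/lpi_eqP/lpi_repr. Qed.

Lemma lquot_scaleA a b x :
  lquot_scale a (lquot_scale b x) = lquot_scale (a * b) x.
Proof. by rewrite -(lpi_repr x) !lquot_scaleE scalerA. Qed.
Lemma lquot_scale1 : left_id 1 lquot_scale.
Proof. by move=> x; rewrite -(lpi_repr x) !lquot_scaleE scale1r. Qed.
Lemma lquot_scaleDr : right_distributive lquot_scale +%R.
Proof.
move=> a x y; rewrite -(lpi_repr x) -(lpi_repr y) -raddfD.
by rewrite !lquot_scaleE scalerDr raddfD.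
Qed.
Lemma lquot_scaleDl x : {morph lquot_scale^~ x : a b / a + b}.
Proof. by move=> a b; rewrite -(lpi_repr x) !lquot_scaleE scalerDl raddfD. Qed.
HB.instance Definition _ := GRing.Zmodule_isLmodule.Build K lquot
  lquot_scaleA lquot_scale1 lquot_scaleDr lquot_scaleDl.

Lemma lpi_is_scalable : scalable lpi.
Proof. by move=> c x; rewrite [RHS]lquot_scaleE. Qed.
HB.instance Definition _ :=
  GRing.isScalable.Build K V lquot *:%R lpi lpi_is_scalable.

End QuotientModule.

Definition bilinear_map (K : fieldType) (U V W : lmodType K)
    (f : U -> V -> W) : Prop :=
  (forall u, linear (f u)) /\ (forall v, linear (f^~ v)).

Section Tensor.
Variables (K : fieldType) (V W : lmodType K).
Let F : Type := {malg K[(V * W)%type]}.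
Let e v w : F := << (v, w) >>.

Inductive tensor_rel : F -> Prop :=
| TensorRelL a v v' w : tensor_rel (e (a *: v + v') w - (a *: e v w + e v' w))
| TensorRelR a v w w' : tensor_rel (e v (a *: w + w') - (a *: e v w + e v w'))
| TensorRel0 : tensor_rel 0
| TensorRelD a x y : tensor_rel x -> tensor_rel y -> tensor_rel (a *: x + y).

Definition tensor_relb : {pred F} := fun x => `[< tensor_rel x >].
Lemma tensor_rel_closed : submod_closed tensor_relb.
Proof.
split=> [|a x y /asboolP hx /asboolP hy]; apply/asboolP; first exact: TensorRel0.
exact: TensorRelD.
Qed.
HB.instance Definition _ :=
  GRing.isSubmodClosed.Build K F tensor_relb tensor_rel_closed.

Definition tensor : Type := lquot tensor_relb.
HB.instance Definition _ := GRing.Lmodule.on tensor.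

Definition tens (v : V) (w : W) : tensor := lpi tensor_relb (e v w).

Lemma tens_bilinear : bilinear_map tens.
Proof.
split=> [v a w w'|w a v v']; apply/eqP; rewrite -subr_eq0 /tens.
  rewrite -linearP -raddfB /= lpi_eq0; apply/asboolP; exact: TensorRelR.
rewrite -linearP -raddfB /= lpi_eq0; apply/asboolP; exact: TensorRelL.
Qed.

(* For bilinear [f], the linear map with [v (x) w |-> f v w]. *)
Definition tensor_lift (X : lmodType K) (f : V -> W -> X) (t : tensor) : X :=
  \sum_(p <- msupp (repr t)) (repr t)@_p *: f p.1 p.2.

Section Lift.
Variables (X : lmodType K) (f : V -> W -> X).
Let g (x : F) : X := \sum_(p <- msupp x) x@_p *: f p.1 p.2.

Lemma free_liftEw (d : {fset (V * W)%type}) (x : F) :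
  (msupp x `<=` d)%fset -> g x = \sum_(p <- d) x@_p *: f p.1 p.2.
Proof.
move=> le; rewrite /g (big_fset_incl _ le) => //= p _ /mcoeff_outdom ->.
by rewrite scale0r.
Qed.

Lemma free_lift_linear a x y : g (a *: x + y) = a *: g x + g y.
Proof.
have le1 := fsubsetUl (msupp x) (msupp y).
have le2 := fsubsetUr (msupp x) (msupp y).
rewrite (free_liftEw le1) (free_liftEw le2).
rewrite (@free_liftEw (msupp x `|` msupp y)%fset); last first.
  by rewrite (fsubset_trans (msuppD_le _ _))// fsetSU// msuppZ_le.
rewrite scaler_sumr -big_split /=; apply: eq_bigr => p _.
by rewrite mcoeffD mcoeffZ scalerDl scalerA.
Qed.

Lemma free_liftU v w : g (e v w) = f v w.
Proof.
by rewrite (free_liftEw msuppU_le) big_seq_fset1 /= mcoeffUU scale1r.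
Qed.

Hypothesis fbil : bilinear_map f.

Lemma free_lift_rel x : tensor_rel x -> g x = 0.
Proof.
have g0 : g 0 = 0 by rewrite /g msupp0 big_seq_fset0.
have gB x1 x2 : g (x1 - x2) = g x1 - g x2.
  by rewrite addrC -[- x2]scaleN1r free_lift_linear scaleN1r addrC.
elim=> {x} [a v v' w|a v w w'||a x y _ IHx _ IHy] //.
- by rewrite gB free_lift_linear !free_liftU fbil.2 subrr.
- by rewrite gB free_lift_linear !free_liftU fbil.1 subrr.
- by rewrite free_lift_linear IHx IHy scaler0 addr0.
Qed.

Lemma tensor_lift_pi x : tensor_lift f (lpi tensor_relb x) = g x.
Proof.
set y := repr (lpi tensor_relb x); rewrite -[LHS]/(g y).
have /asboolP/free_lift_rel : y - x \in tensor_relb.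
  by apply/lpi_eqP; rewrite lpi_repr.
rewrite addrC -[- x]scaleN1r free_lift_linear scaleN1r addrC.
by move/eqP; rewrite subr_eq0 => /eqP.
Qed.

Lemma tensor_liftE v w : tensor_lift f (tens v w) = f v w.
Proof. by rewrite tensor_lift_pi free_liftU. Qed.

Lemma tensor_lift_linear : linear (tensor_lift f).
Proof.
move=> a x y; rewrite -(lpi_repr x) -(lpi_repr y) -linearP.
by rewrite !tensor_lift_pi free_lift_linear.
Qed.

End Lift.
End Tensor.

Section PresentedAlgebra.
Variables (K : fieldType) (G : choiceType).

Definition free_alg : Type := {malg K[{fmonom G}]}.
HB.instance Definition _ := GRing.Lalgebra.on free_alg.

Definition fgen (g : G) : free_alg := << fmu g >>.

Variable rel : free_alg -> Prop.

Inductive ideal_gen : free_alg -> Prop :=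
| IdealRel x : rel x -> ideal_gen x
| Ideal0 : ideal_gen 0
| IdealD x y : ideal_gen x -> ideal_gen y -> ideal_gen (x + y)
| IdealMl a x : ideal_gen x -> ideal_gen (a * x)
| IdealMr x a : ideal_gen x -> ideal_gen (x * a).

Lemma ideal_genZ c x : ideal_gen x -> ideal_gen (c *: x).
Proof.
by move=> hx; rewrite -[x in c *: x]mul1r scalerAl; apply: IdealMl.
Qed.

Definition ideal_genb : {pred free_alg} := fun x => `[< ideal_gen x >].
Lemma ideal_genP x : reflect (ideal_gen x) (x \in ideal_genb).
Proof. exact: asboolP. Qed.
Lemma ideal_gen_closed : submod_closed ideal_genb.
Proof.
split=> [|a x y /asboolP hx /asboolP hy]; apply/asboolP; first exact: Ideal0.
by apply: IdealD hy; apply: ideal_genZ.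
Qed.
HB.instance Definition _ :=
  GRing.isSubmodClosed.Build K free_alg ideal_genb ideal_gen_closed.

Definition presented : Type := lquot ideal_genb.
HB.instance Definition _ := GRing.Lmodule.on presented.
HB.instance Definition _ := EqQuotient.on presented.

Definition ppi (x : free_alg) : presented := lpi ideal_genb x.
HB.instance Definition _ :=
  GRing.isLinear.Build K free_alg presented *:%R ppi (linearP (lpi ideal_genb)).

Lemma ppi_eqP x y : (ppi x = ppi y) <-> ideal_gen (x - y).
Proof. by split=> [/lpi_eqP/ideal_genP|/ideal_genP/lpi_eqP]. Qed.

Lemma ppi_repr x : ppi (repr x) = x. Proof. exact: lpi_repr. Qed.

Definition pmul (x y : presented) : presented := ppi (repr x * repr y).

Lemma pmulE x y : pmul (ppi x) (ppi y) = ppi (x * y).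
Proof.
apply/ppi_eqP; set x' := repr _; set y' := repr _.
have -> : x' * y' - x * y = x' * (y' - y) + (x' - x) * y.
  by rewrite mulrBr mulrBl addrA subrK.
by apply: IdealD; [apply: IdealMl|apply: IdealMr]; apply/ppi_eqP/ppi_repr.
Qed.

Lemma pmulA : associative pmul.
Proof.
by move=> x y z; rewrite -(ppi_repr x) -(ppi_repr y) -(ppi_repr z) !pmulE mulrA.
Qed.
Lemma pmul1r : left_id (ppi 1) pmul.
Proof. by move=> x; rewrite -(ppi_repr x) pmulE mul1r. Qed.
Lemma pmulr1 : right_id (ppi 1) pmul.
Proof. by move=> x; rewrite -(ppi_repr x) pmulE mulr1. Qed.
Lemma pmulDl : left_distributive pmul +%R.
Proof.
move=> x y z; rewrite -(ppi_repr x) -(ppi_repr y) -(ppi_repr z).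
by rewrite -linearD !pmulE mulrDl linearD.
Qed.
Lemma pmulDr : right_distributive pmul +%R.
Proof.
move=> x y z; rewrite -(ppi_repr x) -(ppi_repr y) -(ppi_repr z).
by rewrite -linearD !pmulE mulrDr linearD.
Qed.
HB.instance Definition _ := GRing.Zmodule_isPzRing.Build presented
  pmulA pmul1r pmulr1 pmulDl pmulDr.

Lemma ppi_is_monoid_morphism : monoid_morphism ppi.
Proof. by split=> [|x y]; rewrite -?pmulE. Qed.
HB.instance Definition _ :=
  GRing.isMonoidMorphism.Build free_alg presented ppi ppi_is_monoid_morphism.

Definition pgen (g : G) : presented := ppi (fgen g).

Section Twist.
Variables (M : zmodType) (deg : G -> M) (chi : M -> M -> K).

Definition wdeg (w : {fmonom G}) : M := \sum_(g <- (w : seq G)) deg g.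

Lemma wdegM w w' : wdeg (mmul w w') = wdeg w + wdeg w'.
Proof. by rewrite /wdeg fmM big_cat. Qed.

Definition fhomog (d : M) (x : free_alg) : Prop :=
  forall w, w \in msupp x -> wdeg w = d.

Definition homog (d : M) (a : presented) : Prop :=
  exists2 x, fhomog d x & a = ppi x.

Definition ftwist (x y : free_alg) : free_alg :=
  \sum_(w <- msupp x) \sum_(w' <- msupp y)
     << x@_w * y@_w' * chi (wdeg w) (wdeg w') *g (mmul w w') >>.

(* Well defined as soon as the relations are homogeneous, see [twist_mul_pi];
   then it is the bilinear product of [twist_mulE]. *)
Definition twist_mul (a b : presented) : presented :=
  ppi (ftwist (repr a) (repr b)).

Lemma fhomogN0 d x : (forall w, x@_w != 0 -> wdeg w = d) -> fhomog d x.
Proof. by move=> h w wx; apply: h; rewrite mcoeff_neq0. Qed.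
Lemma fhomog0 d : fhomog d 0.
Proof. by move=> w; rewrite msupp0 in_fset0. Qed.
Lemma fhomogD d x y : fhomog d x -> fhomog d y -> fhomog d (x + y).
Proof.
by move=> hx hy w /(fsubsetP (msuppD_le _ _)); rewrite in_fsetU => /orP[/hx|/hy].
Qed.
Lemma fhomogZ d c x : fhomog d x -> fhomog d (c *: x).
Proof. by move=> hx w /(fsubsetP (msuppZ_le _ _))/hx. Qed.
Lemma fhomogB d x y : fhomog d x -> fhomog d y -> fhomog d (x - y).
Proof. by move=> hx hy; rewrite -scaleN1r; apply/fhomogD/fhomogZ. Qed.
Lemma fhomog_sum d (J : Type) (r : seq J) (P : pred J) (x : J -> free_alg) :
  (forall i, P i -> fhomog d (x i)) -> fhomog d (\sum_(i <- r | P i) x i).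
Proof. by move=> hx; elim/big_rec: _ => [|i y /hx hi]; [exact: fhomog0|exact: fhomogD]. Qed.
Lemma fhomogU c w : fhomog (wdeg w) << c *g w >>.
Proof. by move=> w' /(fsubsetP msuppU_le); rewrite in_fset1 => /eqP->. Qed.
Lemma fhomogM d d' x y : fhomog d x -> fhomog d' y -> fhomog (d + d') (x * y).
Proof.
by move=> hx hy w /msuppM_le [w1 [w2 [/hx <- /hy <- ->]]]; rewrite wdegM.
Qed.
Lemma fhomog1 : fhomog 0 1.
Proof. by have := @fhomogU 1 mone; rewrite /wdeg fm1 big_nil. Qed.
Lemma fhomog_gen g : fhomog (deg g) (fgen g).
Proof. by have := @fhomogU 1 (fmu g); rewrite /wdeg fmU big_seq1. Qed.
Lemma fhomogX d x k : fhomog d x -> fhomog (d *+ k) (x ^+ k).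
Proof.
move=> hx; elim: k => [|k IH]; first exact: fhomog1.
by rewrite exprS mulrS; apply: fhomogM.
Qed.

Lemma ftwistEw (E E' : {fset {fmonom G}}) (x y : free_alg) :
    (msupp x `<=` E)%fset -> (msupp y `<=` E')%fset ->
  ftwist x y = \sum_(w <- E) \sum_(w' <- E')
     << x@_w * y@_w' * chi (wdeg w) (wdeg w') *g (mmul w w') >>.
Proof.
move=> le le'; rewrite /ftwist (big_fset_incl _ le) => /= [|w _ /mcoeff_outdom ->].
  apply: eq_bigr => w _; rewrite (big_fset_incl _ le') //= => w' _.
  by move/mcoeff_outdom ->; rewrite mulr0 mul0r monalgU0.
by rewrite big1// => w' _; rewrite !mul0r monalgU0.
Qed.

Lemma malgUZ c d (w : {fmonom G}) :
  << c * d *g w >> = c *: (<< d *g w >> : free_alg).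
Proof. by apply/malgP => w'; rewrite mcoeffZ !mcoeffU mulrnAr. Qed.

Lemma ftwist_linear_l y a x x' :
  ftwist (a *: x + x') y = a *: ftwist x y + ftwist x' y.
Proof.
set E := (msupp x `|` msupp x')%fset.
have leE : (msupp (a *: x + x') `<=` E)%fset.
  by rewrite (fsubset_trans (msuppD_le _ _))// fsetSU// msuppZ_le.
rewrite (ftwistEw leE (fsubset_refl _)).
rewrite (ftwistEw (fsubsetUl _ _ : (msupp x `<=` E)%fset) (fsubset_refl _)).
rewrite (ftwistEw (fsubsetUr _ _ : (msupp x' `<=` E)%fset) (fsubset_refl _)).
rewrite scaler_sumr -big_split /=; apply: eq_bigr => w _.
rewrite scaler_sumr -big_split /=; apply: eq_bigr => w' _.
by rewrite mcoeffD mcoeffZ !mulrDl monalgUD -!mulrA malgUZ.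
Qed.

Lemma ftwist_linear_r y a x x' :
  ftwist y (a *: x + x') = a *: ftwist y x + ftwist y x'.
Proof.
set E := (msupp x `|` msupp x')%fset.
have leE : (msupp (a *: x + x') `<=` E)%fset.
  by rewrite (fsubset_trans (msuppD_le _ _))// fsetSU// msuppZ_le.
rewrite (ftwistEw (fsubset_refl _) leE).
rewrite (ftwistEw (fsubset_refl _) (fsubsetUl _ _ : (msupp x `<=` E)%fset)).
rewrite (ftwistEw (fsubset_refl _) (fsubsetUr _ _ : (msupp x' `<=` E)%fset)).
rewrite scaler_sumr -big_split /=; apply: eq_bigr => w _.
rewrite scaler_sumr -big_split /=; apply: eq_bigr => w' _.
by rewrite mcoeffD mcoeffZ mulrDr mulrDl monalgUD -malgUZ !mulrA (mulrC a).
Qed.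

Definition ftwistr (y x : free_alg) := ftwist x y.
HB.instance Definition _ y :=
  GRing.isLinear.Build K free_alg free_alg _ (ftwist y) (ftwist_linear_r y).
HB.instance Definition _ y :=
  GRing.isLinear.Build K free_alg free_alg _ (ftwistr y) (ftwist_linear_l y).

Lemma ftwist_homog d d' x y : fhomog d x -> fhomog d' y ->
  ftwist x y = chi d d' *: (x * y).
Proof.
move=> hx hy; rewrite malgME /ftwist scaler_sumr big_seq [RHS]big_seq.
apply: eq_bigr => w /hx dw; rewrite scaler_sumr big_seq [RHS]big_seq.
by apply: eq_bigr => w' /hy dw'; rewrite dw dw' mulrC malgUZ.
Qed.

Hypothesis rel_homog : forall x, rel x -> exists d, fhomog d x.

Let hideal x := exists s : seq free_alg, x = \sum_(y <- s) y /\
  forall y, y \in s -> ideal_gen y /\ exists d, fhomog d y.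

Let hideal1 d y : ideal_gen y -> fhomog d y -> hideal y.
Proof.
move=> iy hy; exists [:: y]; split=> [|z]; first by rewrite big_seq1.
by rewrite inE => /eqP->; split=> //; exists d.
Qed.
Let hideal0 : hideal 0.
Proof. by exists [::]; rewrite big_nil. Qed.
Let hidealD x y : hideal x -> hideal y -> hideal (x + y).
Proof.
move=> [s [-> hs]] [t [-> ht]]; exists (s ++ t); rewrite big_cat; split=> // z.
by rewrite mem_cat => /orP[/hs|/ht].
Qed.
Let hideal_sum (J : eqType) (r : seq J) (x : J -> free_alg) :
  (forall i, i \in r -> hideal (x i)) -> hideal (\sum_(i <- r) x i).
Proof.
by move=> hx; rewrite big_seq; elim/big_rec: _ => // i y /hx hi; apply: hidealD.
Qed.

Lemma ideal_gen_homog x : ideal_gen x -> hideal x.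
Proof.
elim=> {x}[x rx||x y _ hx _ hy|a x _ [s [-> hs]]|x a _ [s [-> hs]]].
- by have [d hd] := rel_homog rx; apply: (hideal1 _ hd); apply: IdealRel.
- exact: hideal0.
- exact: hidealD.
- rewrite mulr_sumr; apply: hideal_sum => y /hs [iy [d hy]].
  rewrite [a]monalgE mulr_suml; apply: hideal_sum => w _.
  apply: (@hideal1 (wdeg w + d)); first exact: IdealMl.
  apply: fhomogM hy. exact: fhomogU.
- rewrite mulr_suml; apply: hideal_sum => y /hs [iy [d hy]].
  rewrite [a]monalgE mulr_sumr; apply: hideal_sum => w _.
  apply: (@hideal1 (d + wdeg w)); first exact: IdealMr.
  by apply: fhomogM hy _; exact: fhomogU.
Qed.

Let ideal_sum (J : eqType) (r : seq J) (x : J -> free_alg) :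
  (forall i, i \in r -> ideal_gen (x i)) -> ideal_gen (\sum_(i <- r) x i).
Proof.
move=> hx; rewrite big_seq; elim/big_rec: _ => [|i y /hx hi]; first exact: Ideal0.
exact: IdealD.
Qed.

Lemma ideal_ftwist_l x y : ideal_gen x -> ideal_gen (ftwist x y).
Proof.
move=> /ideal_gen_homog [s [-> hs]].
rewrite -[ftwist _ _]/(ftwistr _ _) raddf_sum /=; apply: ideal_sum => z /hs.
case=> iz [d hz]; rewrite /ftwistr [y]monalgE raddf_sum; apply: ideal_sum => w _.
by rewrite /= (ftwist_homog hz (@fhomogU _ w)); apply/ideal_genZ/IdealMr.
Qed.

Lemma ideal_ftwist_r x y : ideal_gen y -> ideal_gen (ftwist x y).
Proof.
move=> /ideal_gen_homog [s [-> hs]].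
rewrite raddf_sum /=; apply: ideal_sum => z /hs [iz [d hz]].
rewrite [x]monalgE -[ftwist _ _]/(ftwistr _ _) raddf_sum.
apply: ideal_sum => w _ /=; rewrite /ftwistr (ftwist_homog (@fhomogU _ w) hz).
exact/ideal_genZ/IdealMl.
Qed.

Lemma twist_mul_pi x y : twist_mul (ppi x) (ppi y) = ppi (ftwist x y).
Proof.
apply/ppi_eqP; set x' := repr _; set y' := repr _.
have -> : ftwist x' y' - ftwist x y = ftwist x' (y' - y) + ftwist (x' - x) y.
  by rewrite raddfB -[ftwist (_ - _) _]/(ftwistr _ _) raddfB /= addrA subrK.
by apply: IdealD; [apply: ideal_ftwist_r|apply: ideal_ftwist_l];
  apply/ppi_eqP/ppi_repr.
Qed.

Lemma twist_mul_bilinear : bilinear_map twist_mul.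
Proof.
split=> [a c x y|a c x y];
  rewrite -(ppi_repr a) -(ppi_repr x) -(ppi_repr y) -linearP !twist_mul_pi.
  by rewrite !linearP.
by rewrite -[ftwist _ _]/(ftwistr _ _) !linearP.
Qed.

Lemma twist_mulE d d' a b : homog d a -> homog d' b ->
  twist_mul a b = chi d d' *: (a * b).
Proof.
move=> [x hx ->] [y hy ->].
by rewrite twist_mul_pi (ftwist_homog hx hy) linearZ rmorphM.
Qed.

End Twist.
End PresentedAlgebra.

Section HopfAlgebra.
Variables (K : fieldType).

Record hopf_data (V : lmodType K) := HopfData {
  hmul : V -> V -> V;
  hone : V;
  hcomul : V -> tensor V V;
  hcounit : V -> K;
  hantipode : V -> V }.

Section HopfLaws.
Variables (V : lmodType K) (H : hopf_data V).

Definition tensor_map (V1 V2 W1 W2 : lmodType K) (f : V1 -> W1) (g : V2 -> W2) :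
    tensor V1 V2 -> tensor W1 W2 :=
  tensor_lift (fun v w => tens (f v) (g w)).

Definition tensor_mul (x y : tensor V V) : tensor V V :=
  tensor_lift (fun a b =>
    tensor_lift (fun a' b' => tens (hmul H a a') (hmul H b b')) y) x.

Definition tensor_assoc : tensor (tensor V V) V -> tensor V (tensor V V) :=
  tensor_lift (fun ab c => tensor_lift (fun a b => tens a (tens b c)) ab).

Record is_hopf_algebra : Prop := IsHopfAlgebra {
  hmul_bilinear : bilinear_map (hmul H);
  hmulA : associative (hmul H);
  hmul1 : left_id (hone H) (hmul H);
  hmulr1 : right_id (hone H) (hmul H);
  hcomul_linear : linear (hcomul H);
  hcomulM : forall a b,
    hcomul H (hmul H a b) = tensor_mul (hcomul H a) (hcomul H b);
  hcomul1 : hcomul H (hone H) = tens (hone H) (hone H);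
  hcomulA : forall a,
    tensor_assoc (tensor_map (hcomul H) id (hcomul H a))
    = tensor_map id (hcomul H) (hcomul H a);
  hcounit_linear : forall c a b,
    hcounit H (c *: a + b) = c * hcounit H a + hcounit H b;
  hcounitM : forall a b, hcounit H (hmul H a b) = hcounit H a * hcounit H b;
  hcounit1 : hcounit H (hone H) = 1;
  hcounit_l : forall a, tensor_lift (fun b c => hcounit H b *: c) (hcomul H a) = a;
  hcounit_r : forall a, tensor_lift (fun b c => hcounit H c *: b) (hcomul H a) = a;
  hantipode_linear : linear (hantipode H);
  hantipode_l : forall a,
    tensor_lift (fun b c => hmul H (hantipode H b) c) (hcomul H a)
    = hcounit H a *: hone H;
  hantipode_r : forall a,
    tensor_lift (fun b c => hmul H b (hantipode H c)) (hcomul H a)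
    = hcounit H a *: hone H }.

End HopfLaws.

Record is_hopf_iso (V W : lmodType K) (H : hopf_data V) (H' : hopf_data W)
    (f : V -> W) : Prop := IsHopfIso {
  hiso_linear : linear f;
  hiso_bij : bijective f;
  hisoM : forall a b, f (hmul H a b) = hmul H' (f a) (f b);
  hiso1 : f (hone H) = hone H';
  hiso_comul : forall a, hcomul H' (f a) = tensor_map f f (hcomul H a);
  hiso_counit : forall a, hcounit H' (f a) = hcounit H a;
  hiso_antipode : forall a, hantipode H' (f a) = f (hantipode H a) }.

End HopfAlgebra.

(* Generators: [Gam b e] is gamma^{e 1/2} ([b = true]) or gamma'^{e 1/2}
   ([b = false]); [Ell e i j m] is l_ij^e[-e m]; [EllInv e i] is
   (l_ii^e[0])^-1. Signs are booleans, [true] for +. *)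
Inductive frt_gen (N : nat) : Type :=
| Gam of bool & bool
| Ell of bool & 'I_N & 'I_N & nat
| EllInv of bool & 'I_N.
Arguments Gam {N}.

Section FrtGen.
Variable N : nat.

Definition frt_gen_code (g : frt_gen N) :
    (bool * bool) + (bool * 'I_N * 'I_N * nat) + (bool * 'I_N) :=
  match g with
  | Gam b e => inl (inl (b, e))
  | Ell e i j m => inl (inr (e, i, j, m))
  | EllInv e i => inr (e, i)
  end.
Definition frt_gen_decode
    (c : (bool * bool) + (bool * 'I_N * 'I_N * nat) + (bool * 'I_N)) : frt_gen N :=
  match c with
  | inl (inl (b, e)) => Gam b e
  | inl (inr (e, i, j, m)) => Ell e i j m
  | inr (e, i) => EllInv e i
  end.
Lemma frt_gen_codeK : cancel frt_gen_code frt_gen_decode.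
Proof. by case. Qed.
HB.instance Definition _ := Choice.copy (frt_gen N) (can_type frt_gen_codeK).
End FrtGen.

Section Frt.
Variables (K : fieldType) (N : nat).
Local Notation F := (free_alg K (frt_gen N)).
Local Notation gen := (@fgen K (frt_gen N)).
Local Notation gamh := (gen (Gam true true)).
Local Notation gamh' := (gen (Gam false true)).

Definition esgn (e : bool) : int := if e then 1 else -1.

(* The coefficient of w^x in l_ij^e(w). *)
Definition ell_coef (e : bool) (i j : 'I_N) (x : int) : F :=
  if 0 <= esgn e * x then gen (Ell e i j `|x|%N) else 0.

(* [R k] is the coefficient of z^k in R(z). *)
Variable R : nat -> 'M[K]_(N * N).

(* Coefficient of z^x w^y in the (i1,i2;j1,j2) entry of
   R(z c/w) L_1^{e1}(z) L_2^{e2}(w) and of L_2^{e2}(w) L_1^{e1}(z) R(z c/w),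
   for (e1,e2) one of (+,+), (-,-), (+,-): for these signs the terms with
   k > |x| + |y| vanish. *)
Definition rtt_lhs (c : F) (e1 e2 : bool) (i1 i2 j1 j2 : 'I_N) (x y : int) : F :=
  \sum_(k < (`|x| + `|y|).+1) \sum_(p1 < N) \sum_(p2 < N)
    R k (mxtens_index (i1, i2)) (mxtens_index (p1, p2)) *:
      (c ^+ k * ell_coef e1 p1 j1 (x - k%:Z) * ell_coef e2 p2 j2 (y + k%:Z)).
Definition rtt_rhs (c : F) (e1 e2 : bool) (i1 i2 j1 j2 : 'I_N) (x y : int) : F :=
  \sum_(k < (`|x| + `|y|).+1) \sum_(p1 < N) \sum_(p2 < N)
    R k (mxtens_index (p1, p2)) (mxtens_index (j1, j2)) *:
      (ell_coef e2 i2 p2 (y + k%:Z) * ell_coef e1 i1 p1 (x - k%:Z) * c ^+ k).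

Inductive frt_rel : F -> Prop :=
| FrtCentral b e h :
    frt_rel (gen (Gam b e) * gen h - gen h * gen (Gam b e))
| FrtGamInv b : frt_rel (gen (Gam b true) * gen (Gam b false) - 1)
| FrtTriP (i j : 'I_N) : (i < j)%N -> frt_rel (gen (Ell true i j 0))
| FrtTriN (i j : 'I_N) : (i < j)%N -> frt_rel (gen (Ell false j i 0))
| FrtInvR e i : frt_rel (gen (Ell e i i 0) * gen (EllInv e i) - 1)
| FrtInvL e i : frt_rel (gen (EllInv e i) * gen (Ell e i i 0) - 1)
| FrtRLL e i1 i2 j1 j2 x y :
    frt_rel (rtt_lhs 1 e e i1 i2 j1 j2 x y - rtt_rhs 1 e e i1 i2 j1 j2 x y)
| FrtRLLmix i1 i2 j1 j2 x y :
    frt_rel (rtt_lhs (gamh ^+ 3 * gamh') true false i1 i2 j1 j2 x y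
             - rtt_rhs (gamh * gamh' ^+ 3) true false i1 i2 j1 j2 x y).

(* Coefficient of z^{e m} in the (i,j) entry of
   L^e(z) C L^e(z xi)^{t'} C^-1, with C = diag(c). *)
Definition lcl_coef (c : 'I_N -> K) (xi : K) (e : bool) (i j : 'I_N) (m : nat) : F :=
  \sum_(k < N) \sum_(a < m.+1)
    (c k * xi ^ (esgn e * (m - a)%N%:Z) / c j) *:
      (gen (Ell e i k a) * gen (Ell e (rev_ord j) (rev_ord k) (m - a))).

(* The defining relations of the quotient of U(R(z)); [unimod i] holds for the
   indices with l_ii^{+-}[0] = 1. *)
Inductive frtq_rel (c : 'I_N -> K) (xi : K) (unimod : pred 'I_N) : F -> Prop :=
| FrtqRel x : frt_rel x -> frtq_rel c xi unimod x
| FrtqLCL e i j m :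
    frtq_rel c xi unimod
      (lcl_coef c xi e i j m - ((i == j) && (m == 0%N))%:R)
| FrtqUni e i : unimod i ->
    frtq_rel c xi unimod (gen (Ell e i i 0) - 1).

End Frt.

(* Coefficientwise form of
     Delta(l_ij^+(z)) = sum_k l_ik^+(z (1 (x) gamma^{3/2}))
                              (x) l_kj^+(z (gamma^{1/2} (x) 1)),
     Delta(l_ij^-(z)) = sum_k l_ik^-(z (1 (x) gamma'^{-1/2}))
                              (x) l_kj^-(z (gamma'^{-3/2} (x) 1)),
     S(L^+(z)) = L^+(z gamma^-2)^-1,  S(L^-(z)) = L^-(z gamma'^2)^-1,
   the last line as: S(L) is a left and right inverse of the shifted L. *)
Section FrtHopf.
Variables (K : fieldType) (N : nat) (rel : free_alg K (frt_gen N) -> Prop).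
Local Notation U := (presented rel).
Local Notation gam b e := (pgen rel (Gam b e)).
Local Notation ell e i j m := (pgen rel (Ell e i j m)).

Record is_frt_hopf (H : hopf_data U) : Prop := IsFrtHopf {
  frt_hopf : is_hopf_algebra H;
  frt_mul : hmul H = *%R;
  frt_one : hone H = 1;
  frt_comul_gam b : hcomul H (gam b true) = tens (gam b true) (gam b true);
  frt_comul_ellP i j m : hcomul H (ell true i j m) =
    \sum_(k < N) \sum_(a < m.+1)
      tens (ell true i k a * gam true true ^+ (m - a))
           (gam true true ^+ (3 * a) * ell true k j (m - a));
  frt_comul_ellN i j m : hcomul H (ell false i j m) =
    \sum_(k < N) \sum_(a < m.+1)
      tens (ell false i k a * gam false true ^+ (3 * (m - a)))
           (gam false true ^+ a * ell false k j (m - a));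
  frt_counit_gam b : hcounit H (gam b true) = 1;
  frt_counit_ell e i j m :
    hcounit H (ell e i j m) = ((i == j) && (m == 0%N))%:R;
  frt_antipode_gam b : hantipode H (gam b true) = gam b false;
  frt_antipode_ellL e i j m :
    \sum_(k < N) \sum_(a < m.+1)
      hantipode H (ell e i k a)
      * (gam e false ^+ (4 * (m - a)) * ell e k j (m - a))
    = ((i == j) && (m == 0%N))%:R;
  frt_antipode_ellR e i j m :
    \sum_(k < N) \sum_(a < m.+1)
      (gam e false ^+ (4 * a) * ell e i k a) * hantipode H (ell e k j (m - a))
    = ((i == j) && (m == 0%N))%:R }.
End FrtHopf.

Inductive lie_type := TypeB | TypeC | TypeD.

Definition rank_ok (X : lie_type) (n : nat) : bool :=
  if X is TypeD then (3 <= n)%N else (1 <= n)%N.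

Definition dimN (X : lie_type) (n : nat) : nat :=
  if X is TypeB then n.*2.+1 else n.*2.

(* Transcendental over the prime subfield, in any characteristic. *)
Definition transcendental (K : fieldType) (x : K) : Prop :=
  forall p : {poly int}, map_poly intr p != 0 :> {poly K} ->
    ~~ root (map_poly intr p) x.

(* [rt m] is x^{1/m}. *)
Definition compatible_roots (K : fieldType) (x : K) (rt : nat -> K) : Prop :=
  rt 1%N = x /\
  forall m k, (0 < m)%N -> (0 < k)%N -> rt (m * k)%N ^+ m = rt k.

Section Data.
Variables (K : fieldType) (X : lie_type) (n : nat) (rr sr : nat -> K).
Local Notation N := (dimN X n).

Definition q : K := rr 2 / sr 2.
Definition rs_root (d : nat) : K := rr d * sr d.

Definition vpar : K := if X is TypeB then q ^ (-2) else q ^ (-1).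
Definition xi : K :=
  match X with
  | TypeB => q ^ (2 - 4 * n%:Z)
  | TypeC => q ^ (- 2 - 2 * n%:Z)
  | TypeD => q ^ (2 - 2 * n%:Z)
  end.

(* The index in 1, ..., N of an ordinal; i' is [rev_ord i]. *)
Definition pos (i : 'I_N) : int := (i.+1)%:Z.

Definition tq (i : 'I_N) : K :=
  match X with
  | TypeB => if pos i <= n%:Z then q ^ (2 * (n%:Z - pos i) + 1)
             else if pos i == n%:Z + 1 then q
             else q ^ (2 * (n%:Z + 1 - pos i) + 1)
  | TypeC => if pos i <= n%:Z then q ^ (n%:Z + 1 - pos i)
             else - q ^ (n%:Z - pos i)
  | TypeD => if pos i <= n%:Z then q ^ (n%:Z - pos i)
             else q ^ (n%:Z + 1 - pos i)
  end.

Definition psi (i : 'I_N) : K :=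
  match X with
  | TypeB => if pos i <= n%:Z then rs_root 2 ^ (n%:Z - pos i)
             else if pos i == n%:Z + 1 then 1
             else rs_root 2 ^ (pos i - n%:Z - 2)
  | TypeC => if pos i <= n%:Z then rs_root 4 ^ (n%:Z - pos i)
             else rs_root 4 ^ (pos i - n%:Z - 1)
  | TypeD => if pos i <= n%:Z then rs_root 4 ^ (n%:Z - pos i)
             else rs_root 4 ^ (pos i - n%:Z - 3)
  end.

(* 2 rho_i in type B, rho_i in types C and D. *)
Definition rho (i : 'I_N) : int :=
  match X with
  | TypeB => if pos i <= n%:Z then 2 * (n%:Z - pos i) + 1
             else if pos i == n%:Z + 1 then 1
             else - (2 * (pos i - n%:Z - 2) + 1)
  | TypeC => if pos i <= n%:Z then n%:Z + 1 - pos i else - (pos i - n%:Z)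
  | TypeD => if pos i <= n%:Z then n%:Z - pos i else - (pos i - n%:Z - 1)
  end.
Definition sigma (i : 'I_N) : K :=
  if X is TypeC then (if pos i <= n%:Z then 1 else -1) else 1.
Definition cq (i : 'I_N) : K := sigma i * q ^ rho i.
Definition crs (i : 'I_N) : K := (psi i)^-1 * (psi (rev_ord i))^-1 * cq i.

Definition EE (i j k l : 'I_N) : 'M[K]_(N * N) := delta_mx i j *t delta_mx k l.

Definition flip : 'M[K]_(N * N) := \sum_i \sum_j EE i j j i.

Definition Rhat_q : 'M[K]_(N * N) :=
  let mid := [pred i : 'I_N | pos i == n%:Z + 1] in
  match X with
  | TypeB =>
      q ^ (-2) *: (\sum_(i | ~~ mid i) EE i i i i)
      + \sum_(i | mid i) EE i i i i
      + q ^ 2 *: (\sum_(i | ~~ mid i) EE i (rev_ord i) (rev_ord i) i)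
      + \sum_(i < N) \sum_(j < N | (j != i) && (j != rev_ord i)) EE i j j i
      + (q ^ 2 - q ^ (-2)) *:
          (\sum_(i < N | pos i <= n%:Z)
             (q ^ (4 * (n%:Z - pos i) + 2) - 1) *: EE (rev_ord i) (rev_ord i) i i)
      + (q ^ (-2) - q ^ 2) *:
          (\sum_(i < N) \sum_(j < N | ((j < i)%N) && (j != rev_ord i)) EE i i j j)
      + (q ^ 2 - q ^ (-2)) *:
          (\sum_(i < N) \sum_(j < N | (i < j)%N && (j != rev_ord i))
             (tq i / tq j) *: EE (rev_ord i) j i (rev_ord j))
  | TypeC | TypeD =>
      q^-1 *: (\sum_i EE i i i i)
      + q *: (\sum_i EE i (rev_ord i) (rev_ord i) i)
      + \sum_(i < N) \sum_(j < N | (j != i) && (j != rev_ord i)) EE i j j i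
      + (q^-1 - q) *:
          (\sum_(i < N | pos i <= n%:Z)
             (if X is TypeC then q ^ (2 * (n%:Z + 1 - pos i)) + 1
              else 1 - q ^ (2 * (n%:Z - pos i)))
             *: EE (rev_ord i) (rev_ord i) i i)
      + (q^-1 - q) *:
          (\sum_(i < N) \sum_(j < N | ((j < i)%N) && (j != rev_ord i)) EE i i j j)
      + (q - q^-1) *:
          (\sum_(i < N) \sum_(j < N | (i < j)%N && (j != rev_ord i))
             (tq i / tq j) *: EE (rev_ord i) j i (rev_ord j))
  end.

(* Coordinates in the basis eps_1, ..., eps_n. All degrees below lie in the
   lattice spanned by the eps_i, so the grading group is taken to be this
   lattice rather than the weight lattice P containing it. *)
Definition eps (i : 'I_N) : 'rV[int]_n :=
  \row_k ((k == i :> nat)%:Z - (k == rev_ord i :> nat)%:Z).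

Definition kappa : K := if X is TypeB then rs_root 2 else rs_root 4.
Definition zeta (a b : 'rV[int]_n) : K :=
  kappa ^ (\sum_(i < n) \sum_(j < n | (i < j)%N)
             (a ord0 i * b ord0 j - a ord0 j * b ord0 i)).

Definition Dmx : 'M[K]_(N * N) :=
  \sum_i \sum_j zeta (eps j) (eps i) *: EE i i j j.
Definition Smx : 'M[K]_(N * N) := \sum_i \sum_j (psi i * psi j) *: EE i i j j.
Definition Rhat_rs : 'M[K]_(N * N) :=
  invmx Smx *m Dmx *m Rhat_q *m invmx Dmx *m Smx.

Definition Rhat_aff (Rh : 'M[K]_(N * N)) : 'M[{poly K}]_(N * N) :=
  (vpar%:P * 'X * ('X - 1)) *: map_mx polyC (invmx Rh)
  + (((1 - xi) * (1 - vpar ^+ 2))%:P * 'X)%:M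
  - ((xi * vpar)%:P * ('X - 1)) *: map_mx polyC Rh.

Definition R_aff (Rh : 'M[K]_(N * N)) : 'M[{poly K}]_(N * N) :=
  Rhat_aff Rh *m map_mx polyC flip.

(* f(z) = sum_m f_m z^m with f(0) = 1 and
   f(z) f(z xi) (1 - z v^2) (1 - z v^-2) (1 - z xi) (1 - z xi^-1) = 1. *)
Definition is_normalization (f : nat -> K) : Prop :=
  let g m := \sum_(a < m.+1) f a * (f (m - a)%N * xi ^+ (m - a)) in
  let p : {poly K} := (1 - (vpar ^+ 2) *: 'X) * (1 - (vpar ^- 2) *: 'X)
                      * (1 - xi *: 'X) * (1 - xi^-1 *: 'X) in
  f 0%N = 1 /\
  forall m, \sum_(a < m.+1) g a * p`_(m - a) = (m == 0%N)%:R.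

(* The coefficients of f(z) R(z). *)
Definition R_tilde (f : nat -> K) (Rh : 'M[K]_(N * N)) (k : nat) : 'M[K]_(N * N) :=
  \sum_(a < k.+1) f (k - a)%N *: map_mx (coefp a) (R_aff Rh).

Definition unimod (i : 'I_N) : bool :=
  if X is TypeB then pos i == n%:Z + 1 else false.

Definition rel_q (f : nat -> K) : free_alg K (frt_gen N) -> Prop :=
  frtq_rel (R_tilde f Rhat_q) cq xi unimod.
Definition rel_rs (f : nat -> K) : free_alg K (frt_gen N) -> Prop :=
  frtq_rel (R_tilde f Rhat_rs) crs xi unimod.

Definition Ut_q (f : nat -> K) : Type := presented (rel_q f).
HB.instance Definition _ f := GRing.Lmodule.on (Ut_q f).
HB.instance Definition _ f := GRing.PzRing.on (Ut_q f).
Definition Ut_rs (f : nat -> K) : Type := presented (rel_rs f).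
HB.instance Definition _ f := GRing.Lmodule.on (Ut_rs f).
HB.instance Definition _ f := GRing.PzRing.on (Ut_rs f).

Definition frt_deg (g : frt_gen N) : 'rV[int]_n * 'rV[int]_n :=
  match g with
  | Gam _ _ => (0, 0)
  | Ell _ i j _ => (- eps i, eps j)
  | EllInv _ i => (eps i, - eps i)
  end.

Definition zeta_chi (d d' : 'rV[int]_n * 'rV[int]_n) : K :=
  zeta d.1 d'.1 * (zeta d.2 d'.2)^-1.

Definition zeta_twist (f : nat -> K) (H : hopf_data (Ut_q f)) :
    hopf_data (Ut_q f) :=
  {| hmul := twist_mul (rel := rel_q f) frt_deg zeta_chi;
     hone := hone H;
     hcomul := hcomul H;
     hcounit := hcounit H;
     hantipode := hantipode H |}.

Section Homogeneity.

Let wt (a : 'I_(N * N)) : 'rV[int]_n :=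
  eps (mxtens_unindex a).1 + eps (mxtens_unindex a).2.

Let wp (A : nzRingType) (M : 'M[A]_(N * N)) :=
  forall a b, wt a != wt b -> M a b = 0.

Lemma eps_rev i : eps (rev_ord i) = - eps i.
Proof. by apply/rowP => k; rewrite !mxE rev_ordK opprB. Qed.

Lemma wp0 (A : nzRingType) : wp (0 : 'M[A]_(N * N)).
Proof. by move=> a b _; rewrite mxE. Qed.
Lemma wpD (A : nzRingType) (M M' : 'M[A]_(N * N)) : wp M -> wp M' -> wp (M + M').
Proof. by move=> h h' a b ab; rewrite mxE h ?h' ?addr0. Qed.
Lemma wpN (A : nzRingType) (M : 'M[A]_(N * N)) : wp M -> wp (- M).
Proof. by move=> h a b ab; rewrite mxE h ?oppr0. Qed.
Lemma wpZ (A : nzRingType) c (M : 'M[A]_(N * N)) : wp M -> wp (c *: M).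
Proof. by move=> h a b ab; rewrite mxE h ?mulr0. Qed.
Lemma wp_sum (A : nzRingType) (J : Type) (r : seq J) (P : pred J)
    (M : J -> 'M[A]_(N * N)) :
  (forall j, P j -> wp (M j)) -> wp (\sum_(j <- r | P j) M j).
Proof. by move=> h; elim/big_rec: _ => [|j M' /h]; [exact: wp0|exact: wpD]. Qed.
Lemma wpM (A : nzRingType) (M M' : 'M[A]_(N * N)) : wp M -> wp M' -> wp (M *m M').
Proof.
move=> h h' a b ab; rewrite mxE big1// => c _.
have [ac|ac] := eqVneq (wt a) (wt c); first by rewrite h' ?mulr0// -ac.
by rewrite h ?mul0r.
Qed.
Lemma wp_scalar (A : nzRingType) (c : A) : wp c%:M.
Proof. by move=> a b; rewrite mxE; case: (eqVneq a b) => [->|]; rewrite ?eqxx. Qed.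
Lemma wp_map (A B : nzRingType) (g : {additive A -> B}) (M : 'M[A]_(N * N)) :
  wp M -> wp (map_mx g M).
Proof. by move=> h a b ab; rewrite mxE h ?raddf0. Qed.
Lemma wp_inv (M : 'M[K]_(N * N)) : wp M -> wp (invmx M).
Proof.
move=> h; case: (boolP (M \in unitmx)) => Mu; last by rewrite invmx_out.
move=> a b ab; pose d : 'rV[K]_(N * N) := \row_c (wt c == wt b)%:R.
have comm : M *m diag_mx d = diag_mx d *m M.
  apply/matrixP => c e; rewrite mul_diag_mx mul_mx_diag !mxE.
  by have [->|ce] := eqVneq (wt c) (wt e); rewrite 1?mulrC// h ?mul0r ?mulr0.
have : invmx M *m diag_mx d = diag_mx d *m invmx M.
  by rewrite -[LHS](mulmxK Mu) -(mulmxA _ _ M) -comm mulmxA mulVmx ?mul1mx.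
move/matrixP/(_ a b); rewrite mul_diag_mx mul_mx_diag !mxE eqxx mulr1.
by rewrite (negbTE ab) mul0r.
Qed.
Lemma wp_EE i j k l : eps i + eps k = eps j + eps l -> wp (EE i j k l).
Proof.
move=> e a b; rewrite !mxE /wt.
have [->|] := eqVneq (mxtens_unindex a).1 i; last by rewrite mul0r.
have [->|] := eqVneq (mxtens_unindex b).1 j; last by rewrite mul0r.
have [->|] := eqVneq (mxtens_unindex a).2 k; last by rewrite mulr0.
have [->|] := eqVneq (mxtens_unindex b).2 l; last by rewrite mulr0.
by rewrite e eqxx.
Qed.

Lemma wp_flip : wp flip.
Proof. by do 2!apply: wp_sum => ? _; apply/wp_EE/addrC. Qed.

Lemma wp_Rhat_q : wp Rhat_q.
Proof.
have w1 i : wp (EE i i i i) by apply: wp_EE.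
have w2 i : wp (EE i (rev_ord i) (rev_ord i) i) by apply/wp_EE/addrC.
have w3 i j : wp (EE i j j i) by apply/wp_EE/addrC.
have w4 i : wp (EE (rev_ord i) (rev_ord i) i i) by apply: wp_EE.
have w5 i j : wp (EE i i j j) by apply: wp_EE.
have w6 i j : wp (EE (rev_ord i) j i (rev_ord j)).
  by apply: wp_EE; rewrite !eps_rev addNr subrr.
have w7 (Y : lie_type) (M1 M2 M3 : 'M[K]_(N * N)) : wp M1 -> wp M2 -> wp M3 ->
    wp (match Y with TypeB => M1 | TypeC => M2 | TypeD => M3 end).
  by case: Y.
rewrite /Rhat_q; apply: w7;
  repeat first [apply: wpD | apply: wpZ | apply: wp_sum => ? _ | by []].
Qed.

Lemma wp_R_tilde f Rh k : wp Rh -> wp (R_tilde f Rh k).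
Proof.
move=> h; apply: wp_sum => a _; apply/wpZ/wp_map/wpM; last exact/wp_map/wp_flip.
apply: wpD; last exact/wpN/wpZ/wp_map.
by apply: wpD; [apply/wpZ/wp_map/wp_inv|apply: wp_scalar].
Qed.

Local Notation fhom := (fhomog frt_deg).

Lemma fhomog_ell_coef e i j x : fhom (- eps i, eps j) (ell_coef K e i j x).
Proof.
rewrite /ell_coef; case: ifP => _; last exact: fhomog0.
exact: (@fhomog_gen K _ _ frt_deg (Ell e i j _)).
Qed.

Lemma fhomog_gam b e : fhom 0 (fgen K (Gam b e)).
Proof. exact: (@fhomog_gen K _ _ frt_deg (Gam b e)). Qed.

Lemma fhomog_rtt f Rh c c' e1 e2 i1 i2 j1 j2 x y : wp Rh ->
  fhom 0 c -> fhom 0 c' ->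
  exists d, fhom d (rtt_lhs (R_tilde f Rh) c e1 e2 i1 i2 j1 j2 x y
                    - rtt_rhs (R_tilde f Rh) c' e1 e2 i1 i2 j1 j2 x y).
Proof.
move=> wR hc hc'; exists (- (eps i1 + eps i2), eps j1 + eps j2).
have hR k i i' j j' : R_tilde f Rh k (mxtens_index (i, i')) (mxtens_index (j, j')) = 0
    \/ eps i + eps i' = eps j + eps j'.
  have := @wp_R_tilde f Rh k wR (mxtens_index (i, i')) (mxtens_index (j, j')).
  rewrite /wt !mxtens_indexK /=.
  by case: eqVneq => [|_ /(_ isT)]; [right|left].
apply: fhomogB; apply: fhomog_sum => k _; apply: fhomog_sum => p1 _;
  apply: fhomog_sum => p2 _.
  have [->|->] := hR k i1 i2 p1 p2; first by rewrite scale0r; exact: fhomog0.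
  apply: fhomogZ.
  have := fhomogM (fhomogM (fhomogX (k := k) hc) (@fhomog_ell_coef e1 p1 j1 (x - k%:Z)))
                  (@fhomog_ell_coef e2 p2 j2 (y + k%:Z)).
  by rewrite mul0rn add0r opprD.
have [->|<-] := hR k p1 p2 j1 j2; first by rewrite scale0r; exact: fhomog0.
apply: fhomogZ.
have := fhomogM (fhomogM (@fhomog_ell_coef e2 i2 p2 (y + k%:Z))
                         (@fhomog_ell_coef e1 i1 p1 (x - k%:Z))) (fhomogX (k := k) hc').
by rewrite mul0rn addr0 opprD (addrC (eps p1)) (addrC (- eps i1)).
Qed.

Lemma rel_q_homog f x : rel_q f x -> exists d, fhom d x.
Proof.
have [h1 hg] := (@fhomog1 K _ _ frt_deg, fhomog_gam).
have hgen g : fhom (frt_deg g) (fgen K g) by exact: (@fhomog_gen K _ _ frt_deg g).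
case=> {x} [x|e i j m|e i].
- case=> {x} [b e h|b|i j _|i j _|e i|e i|e i1 i2 j1 j2 x y|i1 i2 j1 j2 x y].
  + exists (frt_deg h); apply: fhomogB.
      by have := fhomogM (@hg b e) (hgen h); rewrite add0r.
    by have := fhomogM (hgen h) (@hg b e); rewrite addr0.
  + exists 0; apply: fhomogB => //; have := fhomogM (hg b true) (hg b false).
    by rewrite add0r.
  + by exists (frt_deg (Ell true i j 0)).
  + by exists (frt_deg (Ell false j i 0)).
  + exists 0; apply: fhomogB => //.
    have := fhomogM (hgen (Ell e i i 0)) (hgen (EllInv e i)).
    by rewrite /= -[_ + _]/(_ + _, _ + _) addNr subrr.
  + exists 0; apply: fhomogB => //.
    have := fhomogM (hgen (EllInv e i)) (hgen (Ell e i i 0)).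
    by rewrite /= -[_ + _]/(_ + _, _ + _) addNr subrr.
  + exact: fhomog_rtt wp_Rhat_q _ _.
  + apply: fhomog_rtt wp_Rhat_q _ _.
      by have := fhomogM (fhomogX (k := 3) (hg true true)) (hg false true); rewrite mul0rn add0r.
    by have := fhomogM (hg true true) (fhomogX (k := 3) (hg false true)); rewrite mul0rn add0r.
- exists (- eps i + eps j, 0); apply: fhomogB.
    apply: fhomog_sum => k _; apply: fhomog_sum => a _; apply: fhomogZ.
    have := fhomogM (hgen (Ell e i k a)) (hgen (Ell e (rev_ord j) (rev_ord k) (m - a)%N)).
    by rewrite /= -[_ + _]/(_ + _, _ + _) !eps_rev opprK subrr.
  have [->|_] := eqVneq i j; last exact: fhomog0.
  by rewrite addNr; case: (m == 0%N) => //; exact: fhomog0.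
- case: (boolP (unimod i)) => // ui _; exists 0; apply: fhomogB => //.
  have ifX (Y : lie_type) (b : bool) :
    (if Y is TypeB then b else false) -> Y = TypeB /\ b by case: Y.
  have [hX /eqP hi] := ifX _ _ ui.
  have ei : i = n :> nat.
    by move/eqP: hi; rewrite /pos -addn1 PoszD (inj_eq (addIr _)) => /eqP[].
  have e0 : eps i = 0.
    by apply/rowP => k; rewrite !mxE /= ei hX /= -addnn subSS addnK subrr.
  by have := hgen (Ell e i i 0); rewrite /= e0 oppr0.
Qed.

Lemma zeta_twist_bilinear f (H : hopf_data (Ut_q f)) :
  bilinear_map (hmul (zeta_twist H)).
Proof. exact: (twist_mul_bilinear _ (@rel_q_homog f)). Qed.

Lemma zeta_twistE f (H : hopf_data (Ut_q f)) d d' (a b : Ut_q f) :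
    hmul H = *%R -> homog frt_deg d a -> homog frt_deg d' b ->
  hmul (zeta_twist H) a b
  = (zeta d.1 d'.1 * (zeta d.2 d'.2)^-1) *: hmul H a b.
Proof. by move=> ->; apply: (twist_mulE _ (@rel_q_homog f)). Qed.

End Homogeneity.
End Data.

(* Main.v *)
Require Import Defs.
From HB Require Import structures.
From mathcomp Require Import all_boot all_order all_algebra.
From mathcomp Require Import finmap boolp monalg mxtens ring.

Set Implicit Arguments.
Unset Strict Implicit.
Unset Printing Implicit Defensive.

Import Order.TTheory GRing.Theory Num.Theory.
Local Open Scope ring_scope.

(* The twisted product of generators g_1, ..., g_k is a scalar multiple of the
   word g_1 ... g_k, so the map sought is induced by a diagonal automorphism of
   the free algebra, w |-> c(w) w, where c(w w') = c(w) c(w') chi(deg w, deg w').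
   Since the two-parameter R-matrix arises from the one-parameter one by
   conjugation with a diagonal matrix, this automorphism sends each defining
   relation of one algebra to a nonzero multiple of a defining relation of the
   other; hence it descends to a linear isomorphism which is multiplicative for
   the twisted product. Compatibility with the coalgebra structure and the
   antipode is checked on generators and extended to words: the coproduct of a
   word is bihomogeneous with opposite inner degrees, whose contributions to the
   twist cancel, and the antipode swaps the two degrees of a word. *)

(** * Tensor products and antipodes *)

(** A coboundary on an abelian group is symmetric, while chi is in general not, so [c] cannot be
    sought as a function of the degree. On the free monoid of words the obstruction disappears: a
    word factors uniquely into letters, and the cocycle condition then determines [c] from arbitrary
    values on the letters. A second difficulty is that the given Hopf structures are prescribed only
    at gamma^{1/2}, gamma'^{1/2} and the l_ij[m], and the antipode of l_ij[m] only through inverse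
    identities. The coproduct, counit and antipode of the inverse generators, a closed formula for
    the antipode of l_ij[m], and the antimultiplicativity of the antipode are therefore derived from
    the Hopf axioms before any induction on words. The twisted product is computed on
    representatives and behaves well only modulo homogeneous relations, so homogeneity is needed on
    both sides of the isomorphism. *)

Section LinearProp.
Variables (K : fieldType) (U V W : lmodType K).

(** The structure maps in [hopf_data] are bare functions whose linearity is a proposition; this and
    the next lemmas give the linear calculus for such unbundled maps. *)
Lemma linear_sumE (g : U -> V) (J : Type) (s : seq J) (P : pred J) (x : J -> U) :
  linear g -> g (\sum_(i <- s | P i) x i) = \sum_(i <- s | P i) g (x i).
Proof.
move=> lg; pose G : {linear U -> V} := HB.pack g (GRing.isLinear.Build K U V _ g lg).
exact: (raddf_sum G).
Qed.

Lemma linearDE (g : U -> V) x y : linear g -> g (x + y) = g x + g y.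
Proof. by move=> lg; rewrite -[x]scale1r lg !scale1r. Qed.

Lemma linear0E (g : U -> V) : linear g -> g 0 = 0.
Proof.
move=> lg; apply: (addrI (g 0)).
by rewrite addr0 -[RHS]addr0 -(linearDE _ _ lg) !addr0.
Qed.

Lemma linearZE (g : U -> V) k x : linear g -> g (k *: x) = k *: g x.
Proof. by move=> lg; rewrite -[k *: x]addr0 lg linear0E // addr0. Qed.

Lemma linear_comp (g : V -> W) (h : U -> V) :
  linear g -> linear h -> linear (fun x => g (h x)).
Proof. by move=> lg lh a x y; rewrite lh lg. Qed.

End LinearProp.

Section TensorProp.
Variables (K : fieldType) (U V W : lmodType K).

(** The coefficient of a simple tensor is absorbed into its left factor, so the induction has no
    scaling case. *)
Lemma tensor_ind (P : tensor V W -> Prop) :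
  P 0 -> (forall v w, P (tens v w)) -> (forall x y, P x -> P y -> P (x + y)) ->
  forall t, P t.
Proof.
move=> P0 Pt PD t; rewrite -(lpi_repr t) [repr t]monalgE raddf_sum /=.
elim/big_ind: _ => // -[v w] _.
have -> : << (repr t)@_(v, w) *g (v, w) >>
    = (repr t)@_(v, w) *: << (v, w) >> :> {malg K[(V * W)%type]}.
  by apply/malgP => p; rewrite mcoeffZ !mcoeffU mulrnAr mulr1.
by rewrite linearZ /= -/(tens v w) -(linearZE _ _ ((tens_bilinear V W).2 w)).
Qed.

Lemma linear_tensor_ext (g h : tensor V W -> U) : linear g -> linear h ->
  (forall v w, g (tens v w) = h (tens v w)) -> forall t, g t = h t.
Proof.
move=> lg lh e; elim/tensor_ind => [|v w|x y hx hy]; last 2 first.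
- exact: e.
- by rewrite (linearDE _ _ lg) (linearDE _ _ lh) hx hy.
by rewrite (linear0E lg) (linear0E lh).
Qed.

(** [tensor_lift] is a finite sum over a chosen representative of [t], so this and the following
    identities hold for arbitrary maps. Bilinearity matters for evaluation at [tens v w] and for
    linearity in [t]. *)
Lemma tensor_lift_ext (f g : V -> W -> U) t :
  (forall v w, f v w = g v w) -> tensor_lift f t = tensor_lift g t.
Proof. by move=> fg; apply: eq_bigr => p _; rewrite fg. Qed.

Lemma tensor_liftD (f g : V -> W -> U) t :
  tensor_lift (fun v w => f v w + g v w) t = tensor_lift f t + tensor_lift g t.
Proof. by rewrite -big_split; apply: eq_bigr => p _; rewrite scalerDr. Qed.

Lemma tensor_liftZ a (f : V -> W -> U) t :
  tensor_lift (fun v w => a *: f v w) t = a *: tensor_lift f t.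
Proof.
rewrite /tensor_lift scaler_sumr; apply: eq_bigr => p _.
by rewrite !scalerA mulrC.
Qed.

End TensorProp.

Lemma tensor_lift_comp (K : fieldType) (V W X Y : lmodType K) (g : X -> Y)
    (f : V -> W -> X) t : linear g ->
  g (tensor_lift f t) = tensor_lift (fun v w => g (f v w)) t.
Proof.
move=> lg; rewrite /tensor_lift linear_sumE //.
by apply: eq_bigr => p _; rewrite linearZE.
Qed.

Lemma tensor_lift_exchange (K : fieldType) (V W V' W' X : lmodType K)
    (f : V -> W -> V' -> W' -> X) (t : tensor V W) (t' : tensor V' W') :
  tensor_lift (fun v w => tensor_lift (f v w) t') t
  = tensor_lift (fun v' w' => tensor_lift (fun v w => f v w v' w') t) t'.
Proof.
rewrite /tensor_lift; under eq_bigr do rewrite scaler_sumr.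
rewrite exchange_big; apply: eq_bigr => p _; rewrite scaler_sumr.
by apply: eq_bigr => p' _; rewrite !scalerA mulrC.
Qed.

Lemma linear_tensor_lift (K : fieldType) (U V W X : lmodType K)
    (f : U -> V -> W -> X) t : (forall v w, linear (fun u => f u v w)) ->
  linear (fun u => tensor_lift (f u) t).
Proof.
move=> lf a x y; rewrite -tensor_liftZ -tensor_liftD.
by apply: tensor_lift_ext => v w; rewrite lf.
Qed.

Section TensorMul.
Variables (K : fieldType) (V : lmodType K) (H : hopf_data V).
Hypothesis mulbil : bilinear_map (hmul H).
Local Notation "x ∙ y" := (hmul H x y) (at level 40, left associativity).

Let mul_tens_bilinear a b : bilinear_map (fun a' b' => tens (a ∙ a') (b ∙ b')).
Proof.
split=> [x|y].
  by apply: (linear_comp (g := tens _)); [exact: (tens_bilinear _ _).1|exact: mulbil.1].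
by apply: (linear_comp (g := fun z => tens z _));
  [exact: (tens_bilinear _ _).2|exact: mulbil.1].
Qed.

Lemma tensor_mul_bilinear : bilinear_map (tensor_mul H).
Proof.
split=> [x k y y'|y].
  rewrite /tensor_mul -tensor_liftZ -tensor_liftD.
  by apply: tensor_lift_ext => a b; rewrite (tensor_lift_linear (mul_tens_bilinear a b)).
apply: tensor_lift_linear; split=> [a|b]; apply: linear_tensor_lift => a' b' k x x'.
  by rewrite (mulbil.2 _) (tens_bilinear _ _).1.
by rewrite (mulbil.2 _) (tens_bilinear _ _).2.
Qed.

Lemma tensor_mulE a b a' b' :
  tensor_mul H (tens a b) (tens a' b') = tens (a ∙ a') (b ∙ b').
Proof.
rewrite /tensor_mul tensor_liftE; first exact: (tensor_liftE (mul_tens_bilinear a b)).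
split=> [x|y]; apply: linear_tensor_lift => c d k x' y'.
  by rewrite (mulbil.2 _) (tens_bilinear _ _).1.
by rewrite (mulbil.2 _) (tens_bilinear _ _).2.
Qed.

Lemma tensor_mulA : associative (hmul H) -> associative (tensor_mul H).
Proof.
have [lr ll] := tensor_mul_bilinear.
move=> mA x y z; move: x; apply: linear_tensor_ext => [||a b].
- exact: ll.
- exact: (linear_comp (g := fun u => tensor_mul H u z)).
move: y; apply: linear_tensor_ext => [||c d].
- exact: (linear_comp (g := tensor_mul H _) (h := fun u => tensor_mul H u z)).
- exact: (linear_comp (g := fun u => tensor_mul H u z)).
move: z; apply: linear_tensor_ext => [||e f].
- exact: (linear_comp (g := tensor_mul H _)).
- exact: lr.
by rewrite !tensor_mulE !mA.
Qed.

Lemma tensor_mul1 : left_id (hone H) (hmul H) ->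
  left_id (tens (hone H) (hone H)) (tensor_mul H).
Proof.
move=> m1; apply: linear_tensor_ext => [||a b] //; first exact: tensor_mul_bilinear.1.
by rewrite tensor_mulE !m1.
Qed.

Lemma tensor_mulr1 : right_id (hone H) (hmul H) ->
  right_id (tens (hone H) (hone H)) (tensor_mul H).
Proof.
move=> m1; apply: linear_tensor_ext => [||a b] //; first exact: tensor_mul_bilinear.2.
by rewrite tensor_mulE !m1.
Qed.

End TensorMul.

Section TensorMap.
Variables (K : fieldType) (V W V' W' : lmodType K).

Lemma tens_comp_bilinear (f : V -> V') (g : W -> W') : linear f -> linear g ->
  bilinear_map (fun v w => tens (f v) (g w)).
Proof.
move=> lf lg; split=> [v|w].
  by apply: (linear_comp (g := tens _)); first exact: (tens_bilinear _ _).1.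
by apply: (linear_comp (g := fun z => tens z _)); first exact: (tens_bilinear _ _).2.
Qed.

Lemma tensor_map_linear (f : V -> V') (g : W -> W') : linear f -> linear g ->
  linear (tensor_map f g).
Proof. by move=> lf lg; apply/tensor_lift_linear/tens_comp_bilinear. Qed.

Lemma tensor_mapE (f : V -> V') (g : W -> W') v w : linear f -> linear g ->
  tensor_map f g (tens v w) = tens (f v) (g w).
Proof. by move=> lf lg; apply/tensor_liftE/tens_comp_bilinear. Qed.

End TensorMap.

Lemma tensor_mapM (K : fieldType) (V W : lmodType K) (H : hopf_data V)
    (H' : hopf_data W) (f : V -> W) x y :
    bilinear_map (hmul H) -> bilinear_map (hmul H') -> linear f ->
    (forall a b, f (hmul H a b) = hmul H' (f a) (f b)) ->
  tensor_map f f (tensor_mul H x y)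
  = tensor_mul H' (tensor_map f f x) (tensor_map f f y).
Proof.
move=> b b' lf fM; have lm := tensor_map_linear lf lf.
have [[lr ll] [lr' ll']] := (tensor_mul_bilinear b, tensor_mul_bilinear b').
move: x; apply: linear_tensor_ext => [||a c].
- exact: (linear_comp (g := tensor_map f f) (h := fun u => tensor_mul H u y)).
- exact: (linear_comp (g := fun u => tensor_mul H' u _)).
move: y; apply: linear_tensor_ext => [||d e].
- exact: (linear_comp (g := tensor_map f f)).
- exact: (linear_comp (g := tensor_mul H' _)).
by rewrite tensor_mulE // !tensor_mapE // tensor_mulE // !fM.
Qed.

(** * Sweedler calculus and the antipode *)

Section HopfTheory.
Variables (K : fieldType) (V : lmodType K) (H : hopf_data V).
Hypothesis hopfH : is_hopf_algebra H.

Local Notation "x ∙ y" := (hmul H x y) (at level 40, left associativity).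
Local Notation S := (hantipode H).
Local Notation eps := (hcounit H).
Local Notation sw a f := (tensor_lift f (hcomul H a)).

Let mulbil := hmul_bilinear hopfH.
Let mulA := hmulA hopfH.
Let lS := hantipode_linear hopfH.

Let lin_mull (U : lmodType K) (g : U -> V) b : linear g -> linear (fun u => g u ∙ b).
Proof. by move=> lg k x y; rewrite lg (mulbil.2 b). Qed.
Let lin_mulr (U : lmodType K) (g : U -> V) b : linear g -> linear (fun u => b ∙ g u).
Proof. by move=> lg k x y; rewrite lg (mulbil.1 b). Qed.

(** Coassociativity in Sweedler form: the identity [hcomulA] in the triple tensor product is pushed
    through the linear map [tensor_lift G] induced by the trilinear [F]. *)
Lemma coassoc_lift (X : lmodType K) (F : V -> V -> V -> X) a :
    (forall y z, linear (fun x => F x y z)) ->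
    (forall x z, linear (fun y => F x y z)) ->
    (forall x y, linear (F x y)) ->
  sw a (fun u z => sw u (fun x y => F x y z))
  = sw a (fun x u => sw u (fun y z => F x y z)).
Proof.
move=> l1 l2 l3.
pose G x (t : tensor V V) := tensor_lift (F x) t.
have FG x : bilinear_map (F x) by split.
have Gb : bilinear_map G.
  split=> [x|t]; first exact: tensor_lift_linear.
  by apply: linear_tensor_lift.
have := congr1 (tensor_lift G) (hcomulA hopfH a).
have A1 (u : tensor V V) : linear (fun z => tensor_lift (fun x y => tens x (tens y z)) u).
  apply: linear_tensor_lift => x y.
  apply: linear_comp; first exact: (tens_bilinear _ _).1.
  exact: (tens_bilinear _ _).1.
have A3 z : bilinear_map (fun x y => tens x (tens y z)).
  split=> [x|y]; last exact: (tens_bilinear _ _).2.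
  apply: linear_comp; first exact: (tens_bilinear _ _).1.
  exact: (tens_bilinear _ _).2.
have A2 : bilinear_map (fun u z => tensor_lift (fun x y : V => tens x (tens y z)) u).
  split=> [u|z]; [exact: A1|exact: tensor_lift_linear].
have lG : linear (tensor_lift G) by apply: tensor_lift_linear.
have lA : linear (@tensor_assoc K V) by apply: tensor_lift_linear.
rewrite /tensor_map !(tensor_lift_comp _ _ lA) !(tensor_lift_comp _ _ lG) => E.
transitivity (sw a (fun u z => tensor_lift G (tensor_assoc (tens (hcomul H u) z)))).
  apply: tensor_lift_ext => u z; rewrite /tensor_assoc tensor_liftE //.
  rewrite (tensor_lift_comp _ _ lG); apply: tensor_lift_ext => x y.
  by rewrite tensor_liftE // /G tensor_liftE.
rewrite E; apply: tensor_lift_ext => x u.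
by rewrite tensor_liftE.
Qed.

Lemma comul_tens_mul a b (X : lmodType K) (f : V -> V -> X) : bilinear_map f ->
  sw (a ∙ b) f = sw a (fun a1 a2 => sw b (fun b1 b2 => f (a1 ∙ b1) (a2 ∙ b2))).
Proof.
move=> fb; have lf : linear (tensor_lift f) by apply: tensor_lift_linear.
rewrite (hcomulM hopfH) /tensor_mul (tensor_lift_comp _ _ lf).
apply: tensor_lift_ext => a1 a2; rewrite (tensor_lift_comp _ _ lf).
by apply: tensor_lift_ext => b1 b2; rewrite tensor_liftE.
Qed.

Lemma hantipode1 : S (hone H) = hone H.
Proof.
have := hantipode_l hopfH (hone H); rewrite (hcomul1 hopfH) tensor_liftE.
  by rewrite (hmulr1 hopfH) (hcounit1 hopfH) scale1r.
split=> [x|y]; last exact: lin_mull.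
exact: (mulbil.1 (S x)).
Qed.

(* Both sides equal the Sweedler sum
   [S b1 . S a1 . a2 . b2 . S (a3 . b3)]. *)
Lemma hantipodeM a b : S (a ∙ b) = S b ∙ S a.
Proof.
pose E := sw a (fun a1 u => sw u (fun a2 a3 => sw b (fun b1 v => sw v
   (fun b2 b3 => S b1 ∙ (S a1 ∙ (a2 ∙ (b2 ∙ S (a3 ∙ b3)))))))).
have lin4 (U : lmodType K) (g : U -> V) : linear g -> linear (fun u => S (g u)).
  by move=> lg k x y; rewrite lg lS.
have E1 : E = S b ∙ S a.
  (* By multiplicativity of the coproduct the inner sum is the right antipode law for the product
     [a2 ∙ b2]. *)
  have inner a2 b2 :
    sw a2 (fun x x' => sw b2 (fun y y' => x ∙ (y ∙ S (x' ∙ y'))))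
     = (eps a2 * eps b2) *: hone H.
    rewrite -(hcounitM hopfH) -(hantipode_r hopfH) comul_tens_mul.
      by apply: tensor_lift_ext => x x'; apply: tensor_lift_ext => y y'; rewrite mulA.
    by split=> [x|y]; [apply/lin_mulr/lin4|apply: lin_mull].
  have -> : E = sw a (fun a1 u => sw b (fun b1 v => eps u *: (S b1 ∙ (S a1 ∙ (eps v *: hone H))))).
    apply: tensor_lift_ext => a1 u; rewrite tensor_lift_exchange.
    apply: tensor_lift_ext => b1 v.
    have lb : linear (fun x => S b1 ∙ (S a1 ∙ x)) by do 2!apply: lin_mulr.
    rewrite -[RHS](linearZE _ _ lb) scalerA -inner !(tensor_lift_comp _ _ lb).
    by apply: tensor_lift_ext => x x'; rewrite (tensor_lift_comp _ _ lb).
  transitivity (sw a (fun a1 u => eps u *: (S b ∙ S a1))).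
    apply: tensor_lift_ext => a1 u; rewrite tensor_liftZ; congr (_ *: _).
    have lb : linear (fun x => S x ∙ S a1) by apply/lin_mull/lin4.
    rewrite -[b in RHS](hcounit_r hopfH) (tensor_lift_comp _ _ lb).
    apply: tensor_lift_ext => b1 v.
    rewrite (linearZE _ _ (mulbil.1 _)) (linearZE _ _ (mulbil.1 _)) (hmulr1 hopfH).
    by rewrite (linearZE _ _ lS) (linearZE _ _ (mulbil.2 _)).
  have lb : linear (fun x => S b ∙ S x) by apply/lin_mulr/lin4.
  rewrite -[a in RHS](hcounit_r hopfH) (tensor_lift_comp _ _ lb).
  apply: tensor_lift_ext => a1 u.
  by rewrite (linearZE _ _ lS) (linearZE _ _ (mulbil.1 _)).
(* With the coproducts bracketed to the left, [S a1] meets [a2] and [S b1] meets [b2]; both pairs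
   contract to counits and leave [S (a ∙ b)]. *)
rewrite -E1 /E -coassoc_lift.
- transitivity (sw a (fun u a3 => eps u *: S (a3 ∙ b))).
    have lb : linear (fun x => S (x ∙ b)) by apply/lin4/lin_mull.
    rewrite -{1}(hcounit_l hopfH a) (tensor_lift_comp _ _ lb).
    by apply: tensor_lift_ext => u a3; rewrite (linearZE _ _ lb).
  apply: tensor_lift_ext => u a3.
  transitivity (sw b (fun b1 v => sw v (fun b2 b3 => eps u *: (S b1 ∙ (b2 ∙ S (a3 ∙ b3)))))).
    rewrite -coassoc_lift.
    + have lb : linear (fun x => S (a3 ∙ x)) by apply/lin4/lin_mulr.
      rewrite -{1}(hcounit_l hopfH b) (tensor_lift_comp _ _ lb) -tensor_liftZ.
      apply: tensor_lift_ext => v b3; rewrite tensor_liftZ; congr (_ *: _).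
      rewrite (linearZE _ _ lb).
      have lc : linear (fun x => x ∙ S (a3 ∙ b3)) by apply: lin_mull.
      rewrite -[X in _ *: X](hmul1 hopfH) -[LHS](linearZE _ _ (mulbil.2 _)).
      rewrite -(hantipode_l hopfH) (tensor_lift_comp _ _ lc).
      by apply: tensor_lift_ext => b1 b2; rewrite mulA.
    + by move=> y z k x x'; rewrite lS (mulbil.2 _) scalerDr !scalerA mulrC.
    + by move=> x z k y y'; rewrite (mulbil.2 _) (mulbil.1 _) scalerDr !scalerA mulrC.
    + move=> x y k z z'.
      by rewrite (mulbil.1 a3) lS !(mulbil.1 _) scalerDr !scalerA mulrC.
  rewrite tensor_lift_exchange; apply: tensor_lift_ext => b1 v.
  rewrite tensor_lift_exchange; apply: tensor_lift_ext => b2 b3.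
  have lc : linear (fun x => S b1 ∙ (x ∙ (b2 ∙ S (a3 ∙ b3)))).
    by apply/lin_mulr/lin_mull.
  rewrite -[X in S b1 ∙ X](hmul1 hopfH).
  rewrite -(linearZE _ _ lc) -(hantipode_l hopfH) (tensor_lift_comp _ _ lc).
  by apply: tensor_lift_ext => a1 a2; rewrite (mulA (S a1)).
- move=> y z; do 2![apply: linear_tensor_lift => ? ?]; apply/lin_mulr/lin_mull.
  exact: lin4.
- move=> x z; do 2![apply: linear_tensor_lift => ? ?]; do 2!apply: lin_mulr.
  exact: lin_mull.
- move=> x y; do 2![apply: linear_tensor_lift => ? ?]; do 4!apply: lin_mulr.
  by apply: lin4; apply: lin_mull.
Qed.

(** The coproduct of [h] is a left inverse and [tens h h] a right inverse of the coproduct of [g].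
    This yields the coproducts of [Gam b false] and [EllInv e i], which [is_frt_hopf] does not
    prescribe. *)
Lemma comul_grouplike_inv g h : g ∙ h = hone H -> h ∙ g = hone H ->
  hcomul H g = tens g g -> hcomul H h = tens h h.
Proof.
move=> gh hg Dg; rewrite -[LHS](tensor_mulr1 mulbil (hmulr1 hopfH)).
rewrite -{1 2}gh -(tensor_mulE mulbil) (tensor_mulA mulbil mulA) -Dg.
by rewrite -(hcomulM hopfH) hg (hcomul1 hopfH) (tensor_mul1 mulbil (hmul1 hopfH)).
Qed.

End HopfTheory.

(** * Diagonal maps of free algebras and cocycles *)

Section FreeAlgebra.
Variables (K : fieldType) (G : choiceType).
Local Notation F := (free_alg K G).

Lemma fmonom_ind (P : {fmonom G} -> Prop) :
  P mone -> (forall g w, P w -> P (mmul (fmu g) w)) -> forall w, P w.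
Proof.
move=> P1 PM [s]; elim: s => [|g s IH]; first by rewrite -fmE.
suff -> : FMonom (g :: s) = mmul (fmu g) (FMonom s) by apply: PM.
by apply/eqP; rewrite fmP fmM fmU.
Qed.

Definition fmon (w : {fmonom G}) : F := << w >>.

Lemma fmonM w w' : fmon w * fmon w' = fmon (mmul w w').
Proof. by rewrite /fmon -[1 in RHS]mulr1; apply: (@fgmulUU _ K 1 1 w w'). Qed.

Lemma fmonMZ w a (x : F) : fmon w * (a *: x) = a *: (fmon w * x).
Proof.
have E (y : F) : a *: y = << a *g mone >> * y by rewrite (mul_malgC a y).
rewrite (E x) (E (fmon w * x)) mulrA [RHS]mulrA.
have -> : fmon w * << a *g mone >> = << a *g mone >> * fmon w; last by [].
rewrite /fmon.
rewrite [LHS](@fgmulUU _ K 1 a w mone) [RHS](@fgmulUU _ K a 1 mone w).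
by rewrite mulm1 mul1m mulrC.
Qed.

Lemma fcoefP a (x y : F) w : (a *: x + y)@_w = a * x@_w + y@_w.
Proof. by rewrite mcoeffD mcoeffZ. Qed.

Lemma free_ind (P : F -> Prop) :
  (forall w, P (fmon w)) -> P 0 -> (forall a x y, P x -> P y -> P (a *: x + y)) ->
  forall x, P x.
Proof.
move=> Pw P0 PD x; rewrite [x]monalgE; elim/big_ind: _ => //.
  by move=> y z hy hz; rewrite -[y]scale1r; apply: PD.
move=> w _; rewrite -[x@_w]mulr1 malgUZ -[_ *: _]addr0.
exact: (PD _ (fmon w) 0).
Qed.

Lemma free_linear_ext (V : lmodType K) (g h : F -> V) : linear g -> linear h ->
  (forall w, g (fmon w) = h (fmon w)) -> forall x, g x = h x.
Proof.
move=> lg lh e; elim/free_ind => [//||a x y hx hy].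
  by rewrite (linear0E lg) (linear0E lh).
by rewrite lg lh hx hy.
Qed.

Section Diagonal.
Variable c : {fmonom G} -> K.

Definition fdiag (x : F) : F := \sum_(w <- msupp x) << c w * x@_w *g w >>.

Lemma mcoeff_fdiag x w : (fdiag x)@_w = c w * x@_w.
Proof.
rewrite raddf_sum /=; case: (msuppP x w) => [hw|hw].
  rewrite (bigD1_seq w) ?fset_uniq //= mcoeffUU big1 ?addr0 // => w' ne.
  by rewrite mcoeffU (negbTE ne) mulr0n.
rewrite mulr0 big_seq big1 // => w' hw'; rewrite mcoeffU.
by case: eqP hw' hw => // -> ->.
Qed.

Lemma fdiag_linear : linear fdiag.
Proof.
move=> a x y; apply/malgP => w.
rewrite (mcoeff_fdiag (a *: x + y)) (fcoefP a x) (fcoefP a (fdiag x)).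
by rewrite (mcoeff_fdiag x) (mcoeff_fdiag y) mulrDr mulrCA.
Qed.
HB.instance Definition _ := GRing.isLinear.Build K F F _ fdiag fdiag_linear.

Lemma fdiag_mon w : fdiag (fmon w) = c w *: fmon w.
Proof.
apply/malgP => w'; rewrite mcoeff_fdiag (mcoeffZ (c w) (fmon w)) mcoeffU.
by case: eqP => [->|_] //; rewrite !mulr0n !mulr0.
Qed.

End Diagonal.

Lemma fdiagK c c' x : (forall w, c w * c' w = 1) -> fdiag c (fdiag c' x) = x.
Proof. by move=> e; apply/malgP => w; rewrite !mcoeff_fdiag mulrA e mul1r. Qed.

Section Cocycle.
Variables (M : zmodType) (deg : G -> M).
Local Notation wd := (wdeg deg).

(** The bicharacter, pulled back to words along the degree, is the coboundary of [c]. This makes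
    [fdiag c] multiplicative from the ordinary product to the twisted one, see [fdiagM]. *)
Definition fcocycle (chi : M -> M -> K) (c : {fmonom G} -> K) : Prop :=
  c mone = 1 /\
  forall w w', c (mmul w w') = c w * c w' * chi (wd w) (wd w').

Lemma fdiag_homog c d x : fhomog deg d x -> fhomog deg d (fdiag c x).
Proof.
move=> hx w; rewrite -mcoeff_neq0 mcoeff_fdiag mulf_eq0 negb_or => /andP[_].
by rewrite mcoeff_neq0 => /hx.
Qed.

Lemma fdiag1 chi c : fcocycle chi c -> fdiag c 1 = 1.
Proof.
by move=> [c1 _]; rewrite -[1 : F]/(fmon mone) fdiag_mon c1 scale1r.
Qed.

Lemma fdiagM chi c x y : fcocycle chi c ->
  fdiag c (x * y) = ftwist deg chi (fdiag c x) (fdiag c y).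
Proof.
move=> [_ cM]; move: x; apply: free_linear_ext => [k x x'|k x x'|w].
- by rewrite mulrDl -scalerAl; apply: fdiag_linear.
- by rewrite fdiag_linear; apply: (ftwist_linear_l deg chi).
move: y; apply: free_linear_ext => [k y y'|k y y'|w'].
- by rewrite mulrDr fmonMZ; apply: fdiag_linear.
- by rewrite fdiag_linear; apply: (ftwist_linear_r deg chi).
rewrite (@ftwist_homog _ _ _ _ _ (wd w) (wd w')); last 2 first.
- by apply: fdiag_homog; apply: fhomogU.
- by apply: fdiag_homog; apply: fhomogU.
rewrite fmonM !fdiag_mon cM -scalerAl fmonMZ fmonM !scalerA.
by have -> : c w * c w' * chi (wd w) (wd w') = chi (wd w) (wd w') * c w * c w'
  by rewrite mulrC mulrA.
Qed.

Lemma fcocycleV (chi : M -> M -> K) c : fcocycle chi c ->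
  fcocycle (fun d d' => (chi d d')^-1) (fun w => (c w)^-1).
Proof. by move=> [c1 cM]; split=> [|w w']; rewrite ?c1 ?invr1 // cM !invfM. Qed.

Definition bicharacter (chi : M -> M -> K) : Prop :=
  [/\ forall d, {morph chi d : a b / a + b >-> a * b},
      forall d, {morph chi^~ d : a b / a + b >-> a * b}
    & forall d d', chi d d' != 0].

Variables (chi : M -> M -> K) (p : G -> K).
Hypothesis chiB : bicharacter chi.

Lemma bicharacter0r d : chi d 0 = 1.
Proof.
have [hr _ h0] := chiB; apply: (mulfI (h0 d 0)).
by rewrite -hr addr0 mulr1.
Qed.
Lemma bicharacter0l d : chi 0 d = 1.
Proof.
have [_ hl h0] := chiB; apply: (mulfI (h0 0 d)).
by rewrite -(hl d) addr0 mulr1.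
Qed.

(** For a bicharacter chi the value at g_1 ... g_k is the product of all p(g_a) and of all chi(deg
    g_a, deg g_b) with a < b, grouped by the first letter. It is the unique cocycle with value p(g)
    on each letter g. *)
Fixpoint seq_coef (s : seq G) : K :=
  if s is g :: s' then p g * seq_coef s' * chi (deg g) (\sum_(h <- s') deg h) else 1.

Definition word_coef (w : {fmonom G}) : K := seq_coef w.

Lemma word_coef_cocycle : fcocycle chi word_coef.
Proof.
have [hr hl _] := chiB.
split=> [|w w']; first by rewrite /word_coef fm1.
rewrite /word_coef /wdeg fmM; elim: (w : seq G) => [|g s IH] /=.
  by rewrite !big_nil bicharacter0l !mul1r mulr1.
rewrite IH big_cat hr big_cons (hl _ (deg g)); ring.
Qed.

Lemma word_coef_gen g : word_coef (fmu g) = p g.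
Proof. by rewrite /word_coef fmU /= big_nil bicharacter0r !mulr1. Qed.

Lemma word_coef_neq0 : (forall g, p g != 0) -> forall w, word_coef w != 0.
Proof.
have [_ _ h0] := chiB; move=> hp w; rewrite /word_coef.
by elim: (w : seq G) => [|g s IH] /=; rewrite ?oner_eq0 // !mulf_neq0.
Qed.

End Cocycle.
End FreeAlgebra.

(** * Descent of diagonal maps to presented algebras *)

Section Transport.
Variables (K : fieldType) (G : choiceType) (M : zmodType) (deg : G -> M).
Variables (chi : M -> M -> K) (c : {fmonom G} -> K).
Variables rel1 rel2 : free_alg K G -> Prop.
Hypothesis cC : fcocycle deg chi c.
Hypothesis hom2 : forall x, rel2 x -> exists d, fhomog deg d x.
Hypothesis rel12 : forall x, rel1 x -> ideal_gen rel2 (fdiag c x).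

(** Multiples of a relation become twisted multiples. These stay in the ideal because [rel2] is
    homogeneous: on homogeneous pieces the twisted product is a scalar multiple of the ordinary
    one. *)
Lemma fdiag_ideal x : ideal_gen rel1 x -> ideal_gen rel2 (fdiag c x).
Proof.
elim=> {x} [x /rel12 //||x y _ hx _ hy|a x _ hx|x a _ hx].
- by rewrite raddf0; apply: Ideal0.
- by rewrite raddfD; apply: IdealD.
- by rewrite (fdiagM _ _ cC); apply: ideal_ftwist_r.
- by rewrite (fdiagM _ _ cC); apply: ideal_ftwist_l.
Qed.

Definition pdiag (a : presented rel1) : presented rel2 := ppi rel2 (fdiag c (repr a)).

Lemma pdiag_pi x : pdiag (ppi rel1 x) = ppi rel2 (fdiag c x).
Proof.
apply/ppi_eqP; rewrite -raddfB; apply: fdiag_ideal.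
by apply/ppi_eqP; rewrite ppi_repr.
Qed.

Lemma pdiag_linear : linear pdiag.
Proof.
move=> k a b; rewrite -(ppi_repr a) -(ppi_repr b) -linearP !pdiag_pi.
by rewrite fdiag_linear linearP.
Qed.

Lemma pdiagM a b : pdiag (a * b) = twist_mul deg chi (pdiag a) (pdiag b).
Proof.
rewrite -(ppi_repr a) -(ppi_repr b) -rmorphM !pdiag_pi (twist_mul_pi _ hom2).
by rewrite (fdiagM _ _ cC).
Qed.

Lemma pdiag1 : pdiag 1 = 1.
Proof. by rewrite -[1]/(ppi rel1 1) pdiag_pi (fdiag1 cC). Qed.

End Transport.

(** * Diagonal maps and the defining relations *)

Lemma fdiagZ (K : fieldType) (G : choiceType) (c : {fmonom G} -> K) k x :
  fdiag c (k *: x) = k *: fdiag c x.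
Proof. exact: (linearZE k x (fdiag_linear c)). Qed.

Lemma fdiagB (K : fieldType) (G : choiceType) (c : {fmonom G} -> K) x y :
  fdiag c (x - y) = fdiag c x - fdiag c y.
Proof. exact: raddfB. Qed.

Lemma fdiag_sum (K : fieldType) (G : choiceType) (c : {fmonom G} -> K)
    (J : Type) (s : seq J) (P : pred J) x :
  fdiag c (\sum_(j <- s | P j) x j) = \sum_(j <- s | P j) fdiag c (x j).
Proof. exact: (linear_sumE s P x (fdiag_linear c)). Qed.

Section Eigen.
Variables (K : fieldType) (G : choiceType) (M : zmodType) (deg : G -> M).
Variables (chi : M -> M -> K) (c : {fmonom G} -> K).
Hypotheses (chiB : bicharacter chi) (cC : fcocycle deg chi c).
Local Notation F := (free_alg K G).

(** The degree is recorded next to the eigenvalue because the eigenvalue of a product involves chi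
    of the two degrees, see [feigenM]. *)
Definition feigen (d : M) (k : K) (x : F) : Prop :=
  fhomog deg d x /\ fdiag c x = k *: x.

Lemma feigen0 d k : feigen d k 0.
Proof. by split; [exact: fhomog0|rewrite raddf0 scaler0]. Qed.

Lemma feigen1 : feigen 0 1 1.
Proof. by split; [exact: fhomog1|rewrite (fdiag1 cC) scale1r]. Qed.

Lemma feigen_gen g : feigen (deg g) (c (fmu g)) (fgen K g).
Proof. by split; [exact: fhomog_gen|exact: fdiag_mon]. Qed.

Lemma feigenM d d' k k' x y : feigen d k x -> feigen d' k' y ->
  feigen (d + d') (k * k' * chi d d') (x * y).
Proof.
move=> [hx ex] [hy ey]; split; first exact: fhomogM.
have L a (u v : F) : ftwist deg chi (a *: u) v = a *: ftwist deg chi u v.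
  exact: (linearZE (g := ftwistr deg chi v) a u (ftwist_linear_l deg chi v)).
have R a (u v : F) : ftwist deg chi v (a *: u) = a *: ftwist deg chi v u.
  exact: (linearZE (g := ftwist deg chi v) a u (ftwist_linear_r deg chi v)).
rewrite (fdiagM x y cC) ex ey L R (ftwist_homog chi hx hy).
rewrite 2!scalerA; reflexivity.
Qed.

Lemma feigenM_val d d' k k' l x y : feigen d k x -> feigen d' k' y ->
  l = k * k' * chi d d' -> fdiag c (x * y) = l *: (x * y).
Proof. by move=> hx hy ->; case: (feigenM hx hy). Qed.

Lemma fdiagB_val l x y x' y' : fdiag c x = l *: x' -> fdiag c y = l *: y' ->
  fdiag c (x - y) = l *: (x' - y').
Proof. by rewrite scalerBr fdiagB => -> ->. Qed.

Lemma feigenX x k : feigen 0 1 x -> feigen 0 1 (x ^+ k).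
Proof.
move=> hx; elim: k => [|k IH]; first exact: feigen1.
have := feigenM hx IH.
by rewrite exprS add0r !mul1r bicharacter0l.
Qed.

End Eigen.

Section RelMap.
Variables (K : fieldType) (X : lie_type) (n : nat).
Local Notation N := (dimN X n).
Local Notation rV := 'rV[int]_n.
Variables (z : rV -> rV -> K) (psi : 'I_N -> K).
Hypotheses (zB : bicharacter z) (z_alt : forall d, z d d = 1).
Hypothesis psi0 : forall i, psi i != 0.

(** Polarisation of [z (d + d') (d + d') = 1]. *)
Lemma alternating_sym d d' : z d' d = (z d d')^-1.
Proof.
have [hr hl h0] := zB; apply: (mulfI (h0 d d')); rewrite divff //.
by have := z_alt (d + d'); rewrite hr !(hl _ d) !z_alt mul1r mulr1 mulrC.
Qed.

Lemma bicharacterNl d d' : z (- d) d' = (z d d')^-1.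
Proof.
have [hr hl h0] := zB; apply: (mulfI (h0 d d')).
by rewrite -(hl d') addrN (bicharacter0l zB) divff.
Qed.
Lemma bicharacterNr d d' : z d (- d') = (z d d')^-1.
Proof.
have [hr hl h0] := zB; apply: (mulfI (h0 d d')).
by rewrite -hr addrN (bicharacter0r zB) divff.
Qed.

(** This is [zeta_chi] for [z = zeta]. Keeping [z] and [psi] abstract lets the same lemmas serve the
    inverse map, with both inverted. *)
Definition bidegree_twist (d d' : rV * rV) : K := z d.1 d'.1 * (z d.2 d'.2)^-1.
Local Notation chi := bidegree_twist.

Lemma bidegree_twist_bicharacter : bicharacter chi.
Proof.
have [hr hl h0] := zB; split=> [d d1 d2|d d1 d2|d d']; rewrite /chi.
- by rewrite !hr; field; rewrite !h0.
- by rewrite !(hl _ d1.1) !(hl _ d1.2); field; rewrite !h0.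
- by rewrite mulf_neq0 ?invr_neq0.
Qed.

(** The value 1 at [EllInv e i] is consistent with the relations: [Ell e i i 0] has coefficient
    psi_i^-1 psi_i = 1, and chi is trivial between the opposite bidegrees of the two generators
    since [z] is alternating. *)
Definition gen_coef (g : frt_gen N) : K :=
  if g is Ell _ i j _ then (psi i)^-1 * psi j else 1.

Lemma gen_coef_neq0 g : gen_coef g != 0.
Proof. by case: g => //= *; rewrite ?oner_neq0 // mulf_neq0 ?invr_neq0. Qed.

Variable c : {fmonom (frt_gen N)} -> K.
Hypotheses (cC : fcocycle (@frt_deg X n) chi c).
Hypothesis c_gen : forall g, c (fmu g) = gen_coef g.

Local Notation eig := (feigen (@frt_deg X n) c).
Let chiB := bidegree_twist_bicharacter.

Lemma eigen_gam b e : eig 0 1 (fgen K (Gam b e)).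
Proof. by have := feigen_gen (@frt_deg X n) c (Gam b e); rewrite c_gen. Qed.

Lemma eigen_ell_coef e i j x :
  eig (- eps i, eps j) ((psi i)^-1 * psi j) (ell_coef K e i j x).
Proof.
rewrite /ell_coef; case: ifP => _; last exact: feigen0.
by have := feigen_gen (@frt_deg X n) c (Ell e i j `|x|%N); rewrite c_gen.
Qed.

Lemma eigen_ell e i j m :
  eig (- eps i, eps j) ((psi i)^-1 * psi j) (fgen K (Ell e i j m)).
Proof. by have := feigen_gen (@frt_deg X n) c (Ell e i j m); rewrite c_gen. Qed.

Lemma eigen_ellinv e i : eig (eps i, - eps i) 1 (fgen K (EllInv e i)).
Proof. by have := feigen_gen (@frt_deg X n) c (EllInv e i); rewrite c_gen. Qed.

Variables (R1 R2 : nat -> 'M[K]_(N * N)) (c1 c2 : 'I_N -> K) (x0 : K).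
Variable uni : pred 'I_N.
(** Entrywise form of the conjugation by S^-1 D. The arguments of [z] appear in opposite orders for
    rows and columns because R(z) is Rhat(z) followed on the right by the flip. *)
Hypothesis R12 : forall k i1 i2 j1 j2,
  R1 k (mxtens_index (i1, i2)) (mxtens_index (j1, j2))
  = (psi i1 * psi i2)^-1 * z (eps i2) (eps i1)
    * R2 k (mxtens_index (i1, i2)) (mxtens_index (j1, j2))
    * (psi j1 * psi j2) * (z (eps j1) (eps j2))^-1.
Hypothesis c12 : forall i, c1 i = (psi i)^-1 * (psi (rev_ord i))^-1 * c2 i.

(** The common scalar of both sides of an RLL relation. In each summand the factors in the inner
    indices p1, p2 coming from the entry of R cancel those from the coefficients and the twist of
    the two l's; only outer indices remain. *)
Let rtt_factor i1 i2 j1 j2 : K :=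
  (psi i1 * psi i2)^-1 * (psi j1 * psi j2) * z (eps i2) (eps i1)
  * (z (eps j1) (eps j2))^-1.

Let z0 d d' : z d d' != 0. Proof. by case: zB. Qed.

Lemma fdiag_rtt_lhs cc e1 e2 i1 i2 j1 j2 x y : eig 0 1 cc ->
  fdiag c (rtt_lhs R1 cc e1 e2 i1 i2 j1 j2 x y)
  = rtt_factor i1 i2 j1 j2 *: rtt_lhs R2 cc e1 e2 i1 i2 j1 j2 x y.
Proof.
move=> hc; rewrite fdiag_sum scaler_sumr; apply: eq_bigr => k _.
rewrite fdiag_sum scaler_sumr; apply: eq_bigr => p1 _.
rewrite fdiag_sum scaler_sumr; apply: eq_bigr => p2 _.
have [_ e] := feigenM cC (feigenM cC (feigenX chiB cC k hc)
  (eigen_ell_coef e1 p1 j1 (x - k%:Z))) (eigen_ell_coef e2 p2 j2 (y + k%:Z)).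
rewrite fdiagZ e [LHS]scalerA [RHS]scalerA; apply: (congr1 (fun u => u *: _)).
rewrite R12 (bicharacter0l chiB) add0r /bidegree_twist /= bicharacterNl bicharacterNr.
rewrite /rtt_factor. by field; rewrite !(psi0, z0, oner_neq0).
Qed.

Lemma fdiag_rtt_rhs cc e1 e2 i1 i2 j1 j2 x y : eig 0 1 cc ->
  fdiag c (rtt_rhs R1 cc e1 e2 i1 i2 j1 j2 x y)
  = rtt_factor i1 i2 j1 j2 *: rtt_rhs R2 cc e1 e2 i1 i2 j1 j2 x y.
Proof.
move=> hc; rewrite fdiag_sum scaler_sumr; apply: eq_bigr => k _.
rewrite fdiag_sum scaler_sumr; apply: eq_bigr => p1 _.
rewrite fdiag_sum scaler_sumr; apply: eq_bigr => p2 _.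
have [_ e] := feigenM cC (feigenM cC (eigen_ell_coef e2 i2 p2 (y + k%:Z))
  (eigen_ell_coef e1 i1 p1 (x - k%:Z))) (feigenX chiB cC k hc).
rewrite fdiagZ e [LHS]scalerA [RHS]scalerA; apply: (congr1 (fun u => u *: _)).
rewrite R12 (bicharacter0r chiB) /bidegree_twist /= bicharacterNl bicharacterNr.
rewrite /rtt_factor. by field; rewrite !(psi0, z0, oner_neq0).
Qed.

(** The factor psi_k^-1 psi_{k'}^-1 in [c1 k] cancels the scalars that l_ik and l_{j'k'} pick up at
    the index k, and [z (eps k) (eps (rev_ord k))] is 1 because these weights are opposite. Hence
    all summands are scaled alike. *)
Lemma fdiag_lcl e i j m :
  fdiag c (lcl_coef c1 x0 e i j m)
  = ((psi i)^-1 * psi j * z (eps j) (eps i)) *: lcl_coef c2 x0 e i j m.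
Proof.
rewrite fdiag_sum scaler_sumr; apply: eq_bigr => k _.
rewrite fdiag_sum scaler_sumr; apply: eq_bigr => a _.
have [_ e'] := feigenM cC (eigen_ell e i k a) (eigen_ell e (rev_ord j) (rev_ord k) (m - a)%N).
rewrite fdiagZ e' [LHS]scalerA [RHS]scalerA; apply: (congr1 (fun u => u *: _)).
rewrite /bidegree_twist /= !eps_rev opprK bicharacterNl bicharacterNr z_alt.
rewrite invr1 invr1 mulr1 !c12 -(alternating_sym (eps i) (eps j)) !invfM !invrK.
set Q := x0 ^ _; set J := (c2 j)^-1.
by field; rewrite !(psi0, z0, oner_neq0).
Qed.

(** The image is a multiple of a single relation rather than just an element of the ideal; this form
    also transfers homogeneity from one set of relations to the other. *)
Lemma fdiag_frtq_rel x : frtq_rel R1 c1 x0 uni x ->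
  exists k y, [/\ k != 0, frtq_rel R2 c2 x0 uni y & fdiag c x = k *: y].
Proof.
have f1 : fdiag c 1 = 1 *: 1 by rewrite (fdiag1 cC) scale1r.
have gX := eigen_gam.
have chi0l := bicharacter0l chiB; have chi0r := bicharacter0r chiB.
have rf0 i1 i2 j1 j2 : rtt_factor i1 i2 j1 j2 != 0.
  by rewrite /rtt_factor !(mulf_neq0, invr_neq0).
have gam3 b k : eig 0 1 (fgen K (Gam b true) ^+ k).
  exact: (feigenX chiB cC k (gX b true)).
have mul0 u v : eig 0 1 u -> eig 0 1 v -> eig 0 1 (u * v).
  by move=> hx hy; have := feigenM cC hx hy; rewrite addr0 chi0l !mulr1.
case=> {x} [x|e i j m|e i ui].
- case=> {x} [b e h|b|i j ij|i j ij|e i|e i|e i1 i2 j1 j2 x y|i1 i2 j1 j2 x y].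
  + exists (gen_coef h), (fgen K (Gam b e) * fgen K h - fgen K h * fgen K (Gam b e)).
    have hh := feigen_gen (@frt_deg X n) c h.
    split; [exact: gen_coef_neq0|by apply/FrtqRel/FrtCentral|].
    apply: fdiagB_val.
      by apply: (feigenM_val cC (gX b e) hh); rewrite c_gen chi0l mul1r mulr1.
    by apply: (feigenM_val cC hh (gX b e)); rewrite c_gen chi0r !mulr1.
  + exists 1, (fgen K (Gam b true) * fgen K (Gam b false) - 1).
    split; [exact: oner_neq0|by apply/FrtqRel/FrtGamInv|apply: fdiagB_val f1].
    by apply: (feigenM_val cC (gX b true) (gX b false)); rewrite chi0l !mulr1.
  + have [_ e1] := eigen_ell true i j 0.
    eexists; eexists; split; last exact: e1; first by rewrite mulf_neq0 ?invr_neq0.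
    by apply/FrtqRel/FrtTriP.
  + have [_ e1] := eigen_ell false j i 0.
    eexists; eexists; split; last exact: e1; first by rewrite mulf_neq0 ?invr_neq0.
    by apply/FrtqRel/FrtTriN.
  + exists 1, (fgen K (Ell e i i 0) * fgen K (EllInv e i) - 1).
    split; [exact: oner_neq0|by apply/FrtqRel/FrtInvR|apply: fdiagB_val f1].
    apply: (feigenM_val cC (eigen_ell e i i 0) (eigen_ellinv e i)).
    by rewrite /bidegree_twist /= bicharacterNl bicharacterNr mulVf // !z_alt !invr1 !mulr1.
  + exists 1, (fgen K (EllInv e i) * fgen K (Ell e i i 0) - 1).
    split; [exact: oner_neq0|by apply/FrtqRel/FrtInvL|apply: fdiagB_val f1].
    apply: (feigenM_val cC (eigen_ellinv e i) (eigen_ell e i i 0)).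
    by rewrite /bidegree_twist /= bicharacterNl bicharacterNr mulVf // !z_alt !invr1 !mulr1.
  + exists (rtt_factor i1 i2 j1 j2).
    exists (rtt_lhs R2 1 e e i1 i2 j1 j2 x y - rtt_rhs R2 1 e e i1 i2 j1 j2 x y).
    split; [exact: rf0|by apply/FrtqRel/FrtRLL|apply: fdiagB_val].
      exact: (fdiag_rtt_lhs e e i1 i2 j1 j2 x y (feigen1 cC)).
    exact: (fdiag_rtt_rhs e e i1 i2 j1 j2 x y (feigen1 cC)).
  + exists (rtt_factor i1 i2 j1 j2).
    exists (rtt_lhs R2 (fgen K (Gam true true) ^+ 3%N * fgen K (Gam false true))
              true false i1 i2 j1 j2 x y
            - rtt_rhs R2 (fgen K (Gam true true) * fgen K (Gam false true) ^+ 3%N)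
              true false i1 i2 j1 j2 x y).
    split; [exact: rf0|by apply/FrtqRel/FrtRLLmix|apply: fdiagB_val].
      exact: (fdiag_rtt_lhs true false i1 i2 j1 j2 x y
                (mul0 _ _ (gam3 true 3%N) (gX false true))).
    exact: (fdiag_rtt_rhs true false i1 i2 j1 j2 x y
              (mul0 _ _ (gX true true) (gam3 false 3%N))).
- exists ((psi i)^-1 * psi j * z (eps j) (eps i)).
  exists (lcl_coef c2 x0 e i j m - ((i == j) && (m == 0%N))%:R); split.
  + by rewrite !mulf_neq0 ?invr_neq0.
  + exact: FrtqLCL.
  + apply: fdiagB_val; first exact: fdiag_lcl.
    (* The constant term is nonzero only for i = j and m = 0, and for i = j the scalar is 1. *)
    case: eqP => [->|_] /=; last by rewrite scaler0; apply: (linear0E (fdiag_linear c)).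
    case: (m == 0%N); last by rewrite scaler0; apply: (linear0E (fdiag_linear c)).
    have -> : (psi j)^-1 * psi j * z (eps j) (eps j) = 1 by rewrite mulVf // z_alt mulr1.
    exact: f1.
- exists 1, (fgen K (Ell e i i 0) - 1).
  split; [exact: oner_neq0|by apply: FrtqUni|apply: fdiagB_val f1].
  by have [_ ->] := eigen_ell e i i 0; rewrite mulVf.
Qed.

End RelMap.

(** * The two-parameter R-matrix *)

Section Gauge.
Variables (K : fieldType) (X : lie_type) (n : nat) (rr sr : nat -> K).
Local Notation N := (dimN X n).
Hypotheses (rs2 : rs_root rr sr 2 != 0) (rs4 : rs_root rr sr 4 != 0).

Lemma psi_neq0 (i : 'I_N) : psi rr sr i != 0.
Proof.
move: i; case: X => i; rewrite /psi; do ?case: ifP => _;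
  by rewrite ?oner_neq0 ?expfz_neq0.
Qed.

Lemma kappa_neq0 : kappa X rr sr != 0.
Proof. by rewrite /kappa; case: (X). Qed.

Lemma zeta_bicharacter : bicharacter (@zeta K X n rr sr).
Proof.
have k0 := kappa_neq0.
split=> [d a b|d a b|a b]; last exact: expfz_neq0.
  rewrite /zeta -expfzDr //; congr (_ ^ _).
  rewrite -big_split; apply: eq_bigr => i _; rewrite -big_split.
  by apply: eq_bigr => j _; rewrite !mxE /=; ring.
rewrite /zeta -expfzDr //; congr (_ ^ _).
rewrite -big_split; apply: eq_bigr => i _; rewrite -big_split.
by apply: eq_bigr => j _; rewrite !mxE /=; ring.
Qed.

Lemma zeta_diag a : @zeta K X n rr sr a a = 1.
Proof.
rewrite /zeta big1 // => i _; rewrite big1 // => j _.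
by rewrite mulrC subrr.
Qed.

Lemma tens_diagE (c : 'I_N -> 'I_N -> K) :
  \sum_i \sum_j c i j *: EE K i i j j
  = diag_mx (\row_a c (mxtens_unindex a).1 (mxtens_unindex a).2).
Proof.
apply/matrixP => a b; rewrite summxE mxE mxE.
have -> : (a == b) = ((mxtens_unindex a).1 == (mxtens_unindex b).1)
                  && ((mxtens_unindex a).2 == (mxtens_unindex b).2).
  by rewrite -(inj_eq (can_inj (@mxtens_unindexK _ _))) -xpair_eqE -!surjective_pairing.
set i := (mxtens_unindex a).1; set j := (mxtens_unindex a).2.
set k := (mxtens_unindex b).1; set l := (mxtens_unindex b).2.
rewrite (bigD1 i) //= summxE (bigD1 j) //= [X in _ + X = _]big1 => [|i' ne]; last first.
  rewrite summxE big1 // => j' _; rewrite !mxE -/i -/k.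
  by rewrite (eq_sym i) (negbTE ne) /= mul0r mulr0.
rewrite big1 => [|j' ne]; last first.
  by rewrite !mxE -/j -/l (eq_sym j) (negbTE ne) /= !mulr0.
rewrite !mxE -/i -/j -/k -/l !eqxx !addr0 /= (eq_sym k) (eq_sym l).
by case: (i == k); case: (j == l); rewrite /= ?mulr1 ?mulr0.
Qed.

Lemma flipE i j k l :
  flip K X n (mxtens_index (i, j)) (mxtens_index (k, l)) = ((i == l) && (j == k))%:R.
Proof.
rewrite summxE (bigD1 i) //= summxE (bigD1 j) //=.
rewrite [X in _ + X = _]big1 => [|i' ne]; last first.
  rewrite summxE big1 // => j' _; rewrite !mxE !mxtens_indexK /=.
  by rewrite (eq_sym i) (negbTE ne) /= mul0r.
rewrite big1 => [|j' ne]; last first.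
  by rewrite !mxE !mxtens_indexK /= (eq_sym j) (negbTE ne) /= mulr0.
rewrite !mxE !mxtens_indexK /= !eqxx !addr0 /= (eq_sym k) (eq_sym l).
by case: (i == l); case: (j == k); rewrite /= ?mulr1 ?mulr0.
Qed.

Lemma invmx_conj m (P A : 'M[K]_m) : P \in unitmx ->
  invmx (P *m A *m invmx P) = P *m invmx A *m invmx P.
Proof.
move=> Pu; have [Au|Au] := boolP (A \in unitmx).
  have PAu : P *m A *m invmx P \in unitmx by rewrite !unitmx_mul Pu Au unitmx_inv.
  apply: (can_inj (mulKmx PAu)); rewrite mulmxV // !mulmxA mulmxKV //.
  by rewrite -(mulmxA P A) mulmxV // mulmx1 mulmxV.
(* On singular matrices [invmx] is the identity, so the formula persists there. *)
have PAu : P *m A *m invmx P \notin unitmx by rewrite !unitmx_mul Pu (negbTE Au).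
by rewrite (invmx_out Au) (invmx_out PAu).
Qed.

(** The diagonal of S^-1 D. *)
Definition gauge_row : 'rV[K]_(N * N) :=
  \row_a ((psi rr sr (mxtens_unindex a).1 * psi rr sr (mxtens_unindex a).2)^-1
    * zeta X rr sr (eps (mxtens_unindex a).2) (eps (mxtens_unindex a).1)).

Lemma gauge_row_neq0 a : gauge_row 0 a != 0.
Proof.
have [_ _ z0] := zeta_bicharacter.
by rewrite mxE mulf_neq0 // invr_neq0 // mulf_neq0 // psi_neq0.
Qed.

Lemma Rhat_rs_conj :
  Rhat_rs X n rr sr
  = diag_mx gauge_row *m Rhat_q X n rr sr *m invmx (diag_mx gauge_row).
Proof.
have [_ _ z0] := zeta_bicharacter.
pose dS : 'rV[K]_(N * N) :=
  \row_a (psi rr sr (mxtens_unindex a).1 * psi rr sr (mxtens_unindex a).2).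
pose dD : 'rV[K]_(N * N) :=
  \row_a zeta X rr sr (eps (mxtens_unindex a).2) (eps (mxtens_unindex a).1).
have eS : Smx X n rr sr = diag_mx dS by exact: (tens_diagE (fun i j => _)).
have eD : Dmx X n rr sr = diag_mx dD by exact: (tens_diagE (fun i j => _)).
have unit_diag (d : 'rV[K]_(N * N)) : (forall a, d 0 a != 0) -> diag_mx d \in unitmx.
  by move=> d0; rewrite unitmxE det_diag unitfE; apply/prodf_neq0 => a _.
have Su : diag_mx dS \in unitmx.
  by apply: unit_diag => a; rewrite mxE mulf_neq0 // psi_neq0.
have Du : diag_mx dD \in unitmx by apply: unit_diag => a; rewrite mxE.
have Uu : diag_mx gauge_row \in unitmx by apply: unit_diag; exact: gauge_row_neq0.
have SU : diag_mx dS *m diag_mx gauge_row = diag_mx dD.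
  rewrite mulmx_diag; congr diag_mx; apply/rowP => a; rewrite !mxE.
  by rewrite mulVKf // mulf_neq0 // psi_neq0.
have -> : diag_mx gauge_row = invmx (diag_mx dS) *m diag_mx dD.
  by rewrite -SU mulKmx.
rewrite /Rhat_rs eS eD; set A := Rhat_q X n rr sr.
have -> : invmx (invmx (diag_mx dS) *m diag_mx dD) = invmx (diag_mx dD) *m diag_mx dS.
  have Pu : invmx (diag_mx dS) *m diag_mx dD \in unitmx by rewrite unitmx_mul unitmx_inv Su.
  apply: (can_inj (mulKmx Pu)); rewrite mulmxV // mulmxA.
  by rewrite mulmxK // mulVmx.
by rewrite !mulmxA.
Qed.

Lemma diag_conjE m (d : 'rV[K]_m) (A : 'M[K]_m) a b : (forall a, d 0 a != 0) ->
  (diag_mx d *m A *m invmx (diag_mx d)) a b = d 0 a * A a b / d 0 b.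
Proof.
move=> d0.
have -> : invmx (diag_mx d) = diag_mx (\row_i (d 0 i)^-1).
  have du : diag_mx d \in unitmx.
    by rewrite unitmxE det_diag unitfE; apply/prodf_neq0 => i _.
  apply: (can_inj (mulKmx du)); rewrite mulmxV // mulmx_diag.
  apply/matrixP => i j; rewrite !mxE.
  by case: (i =P j) => [->|_]; rewrite ?mulr0n // !mulr1n divff.
by rewrite mul_mx_diag mul_diag_mx !mxE.
Qed.

Lemma Rhat_affE (Rh : 'M[K]_(N * N)) a b :
  Rhat_aff rr sr Rh a b
  = (vpar X rr sr)%:P * 'X * ('X - 1) * (invmx Rh a b)%:P
    + (((1 - xi X n rr sr) * (1 - vpar X rr sr ^+ 2))%:P * 'X) *+ (a == b)
    - (xi X n rr sr * vpar X rr sr)%:P * ('X - 1) * (Rh a b)%:P.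
Proof. by rewrite /Rhat_aff; move: (invmx Rh) => A; rewrite !mxE. Qed.

(** Right multiplication by the flip exchanges the two column indices, whence the order of the
    arguments in the column factor of [R_tilde_rsE]. *)
Lemma R_affE (Rh : 'M[K]_(N * N)) a k l :
  R_aff rr sr Rh a (mxtens_index (k, l)) = Rhat_aff rr sr Rh a (mxtens_index (l, k)).
Proof.
rewrite mxE (bigD1 (mxtens_index (l, k))) // big1 => [|c ne].
  by rewrite [LHS]addr0 [X in _ * X]mxE flipE !eqxx; exact: mulr1.
rewrite [X in _ * X]mxE; move: ne; rewrite -(mxtens_unindexK c); case: (mxtens_unindex c) => i j.
rewrite flipE (inj_eq (can_inj (@mxtens_indexK _ _))) xpair_eqE => /negbTE ->.
by rewrite mulr0.
Qed.

(** [Rhat_aff] combines [Rh], its inverse and the identity with scalar polynomial coefficients, so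
    the same diagonal conjugation applies to it; the identity term lies where the gauge quotient is
    1. *)
Lemma Rhat_aff_rsE a b :
  Rhat_aff rr sr (Rhat_rs X n rr sr) a b
  = (gauge_row 0 a / gauge_row 0 b)%:P * Rhat_aff rr sr (Rhat_q X n rr sr) a b.
Proof.
have g0 := gauge_row_neq0.
have Uu : diag_mx gauge_row \in unitmx.
  by rewrite unitmxE det_diag unitfE; apply/prodf_neq0 => i _.
rewrite !Rhat_affE Rhat_rs_conj (invmx_conj _ Uu) !(diag_conjE _ _ _ g0).
set A := invmx (Rhat_q _ _ _ _) a b; set B := Rhat_q _ _ _ _ a b.
set u := gauge_row 0 a; set w := gauge_row 0 b; set V := (vpar X rr sr)%:P * 'X * _.
set W := (xi X n rr sr * _)%:P * _.
have e x : (u * x / w)%:P = (u / w)%:P * x%:P by rewrite -polyCM mulrAC.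
rewrite !e [RHS]mulrBr [X in _ = X - _]mulrDr; congr (_ + _ - _); first by rewrite mulrCA.
  case: eqP => [ab|_]; last by rewrite !mulr0n mulr0.
  by rewrite /w -ab divff ?g0 // mul1r.
by rewrite mulrCA.
Qed.

Lemma R_tilde_rsE f k i1 i2 j1 j2 :
  R_tilde rr sr f (Rhat_rs X n rr sr) k (mxtens_index (i1, i2)) (mxtens_index (j1, j2))
  = (psi rr sr i1 * psi rr sr i2)^-1 * zeta X rr sr (eps i2) (eps i1)
    * R_tilde rr sr f (Rhat_q X n rr sr) k (mxtens_index (i1, i2)) (mxtens_index (j1, j2))
    * (psi rr sr j1 * psi rr sr j2) * (zeta X rr sr (eps j1) (eps j2))^-1.
Proof.
set P1 := _^-1; set z1 := zeta _ _ _ _ _; set P2 := psi _ _ j1 * _; set z2 := _^-1.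
transitivity (P1 * z1 * (P2 * z2)
  * R_tilde rr sr f (Rhat_q X n rr sr) k (mxtens_index (i1, i2)) (mxtens_index (j1, j2)));
  last by ring.
rewrite /R_tilde summxE [in RHS]summxE mulr_sumr; apply: eq_bigr => a _.
rewrite mxE [in RHS]mxE mulrCA; congr (_ * _).
rewrite mxE [in RHS]mxE !R_affE Rhat_aff_rsE /coefp /= coefCM.
rewrite !mxE !mxtens_indexK /= invfM invrK -/P1 -/z1 (mulrC (psi rr sr j2)) -/P2 -/z2.
by [].
Qed.

End Gauge.

(** * Coproduct, counit and antipode on generators *)

Section SeriesInverse.
Variable T : pzRingType.

Definition series_mul (a b : nat -> T) (m : nat) : T :=
  \sum_(k < m.+1) a k * b (m - k)%N.

Lemma series_mul_rev a b m : series_mul a b m = \sum_(k < m.+1) a (m - k)%N * b k.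
Proof.
rewrite /series_mul (reindex_inj rev_ord_inj) /=.
by apply: eq_bigr => k _; rewrite subSS subKn // -ltnS.
Qed.

Lemma series_mulA a b d m :
  series_mul a (series_mul b d) m = series_mul (series_mul a b) d m.
Proof.
rewrite [RHS]series_mul_rev.
pose c3 j k := a j * (b (m - j - k)%N * d k).
transitivity (\sum_(j < m.+1) \sum_(k < m.+1 | (k <= m - j)%N) c3 j k).
  apply: eq_bigr => j _; rewrite series_mul_rev mulr_sumr.
  by rewrite (big_ord_narrow_leq (leq_subr _ _)).
rewrite (exchange_big_dep predT) //=; apply: eq_bigr => k _.
transitivity (\sum_(j < m.+1 | (j <= m - k)%N) c3 j k).
  apply: eq_bigl => j; rewrite -ltnS -(ltnS j) -!subSn ?leq_ord //.
  by rewrite -subn_gt0 -(subn_gt0 j) -!subnDA addnC.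
rewrite (big_ord_narrow_leq (leq_subr _ _)) mulr_suml.
by apply: eq_bigr => j _; rewrite /c3 -!subnDA addnC mulrA.
Qed.

Lemma series_inv_unique a b d :
  (forall m, series_mul a b m = (m == 0)%:R) ->
  (forall m, series_mul b d m = (m == 0)%:R) -> forall m, a m = d m.
Proof.
move=> ab bd m; have := series_mulA a b d m.
rewrite /series_mul; under eq_bigr do rewrite -/(series_mul b d _) bd.
under [in RHS]eq_bigr do rewrite -/(series_mul a b _) ab.
rewrite big_ord_recr /= subnn mulr1 big1 => [|k _]; last first.
  by rewrite subn_eq0 leqNgt ltn_ord mulr0.
rewrite big_ord_recl /= subn0 mul1r big1 => [|k _]; last by rewrite mul0r.
by rewrite add0r addr0.
Qed.

End SeriesInverse.

(** Matrices of series are read as series over the matrix ring, where a left inverse agrees with a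
    right inverse. The antipode of the l's, given only by inverse identities, is identified this
    way. *)
Lemma series_mx_inv_unique (T : pzRingType) (N : nat) (a b d : nat -> 'I_N -> 'I_N -> T) :
  (forall m i j, \sum_(k < N) \sum_(p < m.+1) a p i k * b (m - p)%N k j
                 = ((i == j) && (m == 0%N))%:R) ->
  (forall m i j, \sum_(k < N) \sum_(p < m.+1) b p i k * d (m - p)%N k j
                 = ((i == j) && (m == 0%N))%:R) ->
  forall m i j, a m i j = d m i j.
Proof.
move=> ab bd m i j.
pose mx (u : nat -> 'I_N -> 'I_N -> T) p : 'M[T]_N := \matrix_(i, j) u p i j.
have H (u w : nat -> 'I_N -> 'I_N -> T) :
    (forall m i j, \sum_(k < N) \sum_(p < m.+1) u p i k * w (m - p)%N k j
                 = ((i == j) && (m == 0%N))%:R) ->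
    forall m, series_mul (mx u) (mx w) m = (m == 0)%:R.
  move=> uw p; apply/matrixP => x y; rewrite summxE.
  transitivity (((x == y) && (p == 0%N))%:R : T).
    rewrite -uw exchange_big; apply: eq_bigr => k _.
    by rewrite mxE; apply: eq_bigr => l _; rewrite !mxE.
  by case: (p == 0%N); rewrite ?andbT ?andbF !mxE.
have := series_inv_unique (H _ _ ab) (H _ _ bd) m.
by move/matrixP/(_ i j); rewrite !mxE.
Qed.

Lemma mulrACA_comm (T : pzRingType) (a b g d : T) :
  b * g = g * b -> a * b * (g * d) = a * g * (b * d).
Proof. by move=> bg; rewrite mulrA -(mulrA a) bg !mulrA. Qed.

Section FrtHopf.
Variables (K : fieldType) (N : nat) (R : nat -> 'M[K]_(N * N)) (c : 'I_N -> K).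
Variables (x0 : K) (uni : pred 'I_N).
Local Notation rel := (frtq_rel R c x0 uni).
Local Notation U := (presented rel).
Local Notation gam b e := (pgen rel (Gam b e)).
Local Notation ell e i j m := (pgen rel (Ell e i j m)).
Local Notation ellinv e i := (pgen rel (EllInv e i)).

Lemma ppi_rel x : rel x -> ppi rel x = 0.
Proof.
move=> hx; rewrite -(linear0 (ppi rel)); apply/ppi_eqP.
by rewrite subr0; apply: IdealRel.
Qed.

Lemma ppi_relB x y : rel (x - y) -> ppi rel x = ppi rel y.
Proof. by move=> h; apply/ppi_eqP/IdealRel. Qed.

Lemma ppiM x y : ppi rel (x * y) = ppi rel x * ppi rel y.
Proof. exact: rmorphM. Qed.

Lemma gam_central b e g : gam b e * pgen rel g = pgen rel g * gam b e.
Proof.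
rewrite /pgen -!ppiM; apply: ppi_relB; apply: FrtqRel; exact: FrtCentral.
Qed.

Lemma gamV b : gam b true * gam b false = 1.
Proof. rewrite /pgen -ppiM; apply: ppi_relB; apply: FrtqRel; exact: FrtGamInv. Qed.

Lemma gamVr b : gam b false * gam b true = 1.
Proof. by rewrite gam_central gamV. Qed.

Lemma ellP0 (i j : 'I_N) : (i < j)%N -> ell true i j 0 = 0.
Proof. by move=> ij; apply: ppi_rel; apply: FrtqRel; apply: FrtTriP. Qed.

Lemma ellN0 (i j : 'I_N) : (i < j)%N -> ell false j i 0 = 0.
Proof. by move=> ij; apply: ppi_rel; apply: FrtqRel; apply: FrtTriN. Qed.

Lemma ellV e i : ell e i i 0 * ellinv e i = 1.
Proof. rewrite /pgen -ppiM; apply: ppi_relB; apply: FrtqRel; exact: FrtInvR. Qed.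

Lemma ellVr e i : ellinv e i * ell e i i 0 = 1.
Proof. rewrite /pgen -ppiM; apply: ppi_relB; apply: FrtqRel; exact: FrtInvL. Qed.

Lemma ell_lcl e i j m :
  \sum_(k < N) \sum_(a < m.+1)
    (c k * x0 ^ (esgn e * (m - a)%N%:Z) / c j) *:
      (ell e i k a * ell e (rev_ord j) (rev_ord k) (m - a))
  = ((i == j) && (m == 0%N))%:R.
Proof.
transitivity (ppi rel (lcl_coef c x0 e i j m)).
  have lp : linear (ppi rel) by exact: linearP.
  rewrite /lcl_coef (linear_sumE _ _ _ lp); apply: eq_bigr => k _.
  rewrite (linear_sumE _ _ _ lp); apply: eq_bigr => a _.
  by rewrite (linearZE _ _ lp) ppiM.
rewrite (ppi_relB (y := ((i == j) && (m == 0%N))%:R)); last exact: FrtqLCL.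
exact: rmorph_nat.
Qed.

Variable H : hopf_data U.
Hypothesis HF : is_frt_hopf H.
Local Notation S := (hantipode H).
Let hopfH := frt_hopf HF.

(** Bilinearity is read off from the Hopf axioms, since the Hopf product is the ring product. *)
Lemma frt_mulbil : bilinear_map (fun x y : U => x * y).
Proof. by have := hmul_bilinear hopfH; rewrite (frt_mul HF). Qed.

Lemma frt_scalerAr k (x y : U) : x * (k *: y) = k *: (x * y).
Proof. by have := linearZE (g := fun y : U => x * y) k y (frt_mulbil.1 x). Qed.

Lemma antipode_frtM (a b : U) : S (a * b) = S b * S a.
Proof. by have := hantipodeM hopfH a b; rewrite (frt_mul HF). Qed.
Lemma antipode_frt1 : S 1 = 1.
Proof. by have := hantipode1 hopfH; rewrite (frt_one HF). Qed.

(* Since [L^e(z) C L^e(z xi)^{t'} C^-1 = I], the series [S(L^e(z))], a left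
   inverse of a shift of [L^e(z)], is the right inverse which that relation
   provides. *)
Lemma antipode_ell e i j m :
  S (ell e i j m) = (c i * x0 ^ (esgn e * m%:Z) / c j) *:
    (gam e false ^+ (4 * m)%N * ell e (rev_ord j) (rev_ord i) m).
Proof.
apply: (series_mx_inv_unique (a := fun m i j => S (ell e i j m))
  (b := fun m i j => gam e false ^+ (4 * m)%N * ell e i j m)
  (d := fun m i j => (c i * x0 ^ (esgn e * m%:Z) / c j) *:
    (gam e false ^+ (4 * m)%N * ell e (rev_ord j) (rev_ord i) m))) => {i j m} m i j.
  exact: (frt_antipode_ellL HF).
transitivity (gam e false ^+ (4 * m)%N * ((i == j) && (m == 0%N))%:R); last first.
  by case: m => [|m]; rewrite ?andbF ?mulr0 // muln0 mul1r.
rewrite -(ell_lcl e i j m) mulr_sumr; apply: eq_bigr => k _.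
rewrite mulr_sumr; apply: eq_bigr => p _.
rewrite [LHS]frt_scalerAr [RHS]frt_scalerAr; apply: (congr1 (fun u => _ *: u)).
have pm : (p <= m)%N by rewrite -ltnS.
(* The shift by gamma^{-2} is the fourth power of [gam e false]; its contribution at total degree m
   is distributed over the two factors of degrees p and m - p, which is allowed as it is central. *)
have -> : (4 * m = 4 * p + 4 * (m - p))%N by rewrite -mulnDr subnKC.
rewrite exprD; apply: mulrACA_comm.
by apply/commrX/esym/gam_central.
Qed.

Lemma antipode_gamV b : S (gam b false) = gam b true.
Proof.
have e : S (gam b false) * gam b false = 1.
  by rewrite -{2}(frt_antipode_gam HF b) -antipode_frtM gamV antipode_frt1.
by rewrite -[LHS]mulr1 -(gamVr b) mulrA e mul1r.
Qed.

Lemma antipode_ellinv e i : c i != 0 -> S (ellinv e i) = ellinv e (rev_ord i).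
Proof.
move=> ci.
have Sl : S (ell e i i 0) = ell e (rev_ord i) (rev_ord i) 0.
  by rewrite antipode_ell mulr0 expr0z mulr1 divff // scale1r muln0 expr0 mul1r.
rewrite -[LHS]mulr1 -(ellV e (rev_ord i)) mulrA -Sl -antipode_frtM ellV.
by rewrite antipode_frt1 mul1r.
Qed.

Lemma comul_gamV b : hcomul H (gam b false) = tens (gam b false) (gam b false).
Proof.
apply: (comul_grouplike_inv hopfH (g := gam b true)); last exact: frt_comul_gam.
  by rewrite (frt_mul HF) (frt_one HF) gamV.
by rewrite (frt_mul HF) (frt_one HF) gamVr.
Qed.

(** Zero modes are triangular: for k different from i, one of l_ik[0] and l_ki[0] vanishes. *)
Lemma comul_ell0 e i : hcomul H (ell e i i 0) = tens (ell e i i 0) (ell e i i 0).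
Proof.
have t0l (x : U) : tens x (0 : U) = 0 by exact: (linear0E ((tens_bilinear U U).1 x)).
have t0r (x : U) : tens (0 : U) x = 0 by exact: (linear0E ((tens_bilinear U U).2 x)).
have -> : hcomul H (ell e i i 0) = \sum_(k < N) tens (ell e i k 0) (ell e k i 0).
  have t2 (x y : U) : tens (x * 1) (1 * y) = tens x y by rewrite mulr1 mul1r.
  case: e.
    by rewrite (frt_comul_ellP HF); apply: eq_bigr => k _; rewrite big_ord1; apply: t2.
  by rewrite (frt_comul_ellN HF); apply: eq_bigr => k _; rewrite big_ord1; apply: t2.
rewrite (bigD1 i) // big1 => [|k ki]; first exact: addr0.
have [ik|ik|ik] := ltngtP i k.
- by case: e; [rewrite (ellP0 ik) t0r|rewrite (ellN0 ik) t0l].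
- by case: e; [rewrite (ellP0 ik) t0l|rewrite (ellN0 ik) t0r].
- by move/eqP: ki; case; apply: val_inj.
Qed.

Lemma comul_ellinv e i : hcomul H (ellinv e i) = tens (ellinv e i) (ellinv e i).
Proof.
apply: (comul_grouplike_inv hopfH (g := ell e i i 0)); last exact: comul_ell0.
  by rewrite (frt_mul HF) (frt_one HF) ellV.
by rewrite (frt_mul HF) (frt_one HF) ellVr.
Qed.

Lemma counit_frtM (a b : U) : hcounit H (a * b) = hcounit H a * hcounit H b.
Proof. by have := hcounitM hopfH a b; rewrite (frt_mul HF). Qed.

Lemma counit_frt1 : hcounit H 1 = 1.
Proof. by have := hcounit1 hopfH; rewrite (frt_one HF). Qed.

Lemma counit_gamV b : hcounit H (gam b false) = 1.
Proof.
by rewrite -[LHS]mul1r -{1}(frt_counit_gam HF b) -counit_frtM gamV counit_frt1.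
Qed.

Lemma counit_ellinv e i : hcounit H (ellinv e i) = 1.
Proof.
have l1 : hcounit H (ell e i i 0) = 1 by rewrite (frt_counit_ell HF) eqxx.
by rewrite -[LHS]mul1r -{1}l1 -counit_frtM ellV counit_frt1.
Qed.

End FrtHopf.

(** * Homogeneous elements *)

Section Homogeneous.
Variables (K : fieldType) (G : choiceType) (rel : free_alg K G -> Prop).
Variables (M : zmodType) (deg : G -> M).
Local Notation U := (presented rel).
Local Notation hom := (@homog K G rel M deg).

Lemma homogM d d' (a b : U) : hom d a -> hom d' b -> hom (d + d') (a * b).
Proof.
move=> [x hx ->] [y hy ->]; exists (x * y); first exact: fhomogM.
exact/esym/(rmorphM (ppi rel)).
Qed.

Lemma homogZ d k (a : U) : hom d a -> hom d (k *: a).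
Proof.
move=> [x hx ->]; exists (k *: x); first exact: fhomogZ.
have lp : linear (ppi rel) by exact: linearP.
by rewrite (linearZE k x lp).
Qed.

Lemma homog1 : hom 0 1.
Proof. by exists 1; first exact: fhomog1. Qed.

Lemma homogX k (a : U) : hom 0 a -> hom 0 (a ^+ k).
Proof.
move=> ha; elim: k => [|k IH]; first exact: homog1.
by rewrite exprS -[0]addr0; apply: homogM.
Qed.

Lemma homog_gen g : hom (deg g) (pgen rel g).
Proof. by exists (fgen K g); first exact: fhomog_gen. Qed.

Lemma homog_word w : hom (wdeg deg w) (ppi rel (fmon K w)).
Proof. by exists (fmon K w); first exact: fhomogU. Qed.

Lemma presented_word_ext (V : lmodType K) (g h : U -> V) : linear g -> linear h ->
    (forall w, g (ppi rel (fmon K w)) = h (ppi rel (fmon K w))) ->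
  forall a, g a = h a.
Proof.
move=> lg lh e a; rewrite -(ppi_repr a); move: (repr a).
have lp : linear (ppi rel) by exact: linearP.
apply: (free_linear_ext (g := fun x => g (ppi rel x)) (h := fun x => h (ppi rel x))) => //.
  exact: linear_comp lg lp.
exact: linear_comp lh lp.
Qed.

Lemma ppi_word g w : ppi rel (fmon K (mmul (fmu g) w)) = pgen rel g * ppi rel (fmon K w).
Proof. by rewrite -fmonM; apply: (rmorphM (ppi rel)). Qed.

Lemma ppi_word1 : ppi rel (fmon K mone) = 1.
Proof. by []. Qed.

End Homogeneous.

(** * Bidegrees in the tensor square *)

Section TensorHomogeneous.
Variables (K : fieldType) (G : choiceType) (rel : free_alg K G -> Prop).
Variables (M : zmodType) (deg : G -> M * M).
Local Notation U := (presented rel).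
Local Notation hom := (@homog K G rel (M * M)%type deg).

(** Only the outer degrees are fixed. The inner degree [g] may vary from summand to summand, as
    eps_k does in the coproduct of l_ij. *)
Inductive tensor_homog (d : M * M) : tensor U U -> Prop :=
| TensorHomog0 : tensor_homog d 0
| TensorHomogD u v : tensor_homog d u -> tensor_homog d v -> tensor_homog d (u + v)
| TensorHomogT g x y :
    hom (d.1, g) x -> hom (- g, d.2) y -> tensor_homog d (tens x y).

Lemma tensor_homog_sum d (J : Type) (s : seq J) (P : pred J) (t : J -> tensor U U) :
  (forall j, P j -> tensor_homog d (t j)) ->
  tensor_homog d (\sum_(j <- s | P j) t j).
Proof.
move=> ht; elim/big_ind: _ => // [|u v]; [exact: TensorHomog0|exact: TensorHomogD].
Qed.

Lemma tensor_homogZ d k u : tensor_homog d u -> tensor_homog d (k *: u).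
Proof.
elim=> {u} [|u v _ hu _ hv|g x y hx hy].
- by rewrite scaler0; exact: TensorHomog0.
- by rewrite scalerDr; exact: TensorHomogD.
rewrite -(linearZE _ _ ((tens_bilinear U U).1 x)).
apply: TensorHomogT hx _; exact: homogZ.
Qed.

Variable H : hopf_data U.
Hypotheses (HM : hmul H = *%R) (bil : bilinear_map (hmul H)).

Lemma tensor_homogM d d' u v : tensor_homog d u -> tensor_homog d' v ->
  tensor_homog (d + d') (tensor_mul H u v).
Proof.
have [lr ll] := tensor_mul_bilinear bil.
move=> hu hv; elim: hu => {u} [|u u' _ IH _ IH'|g x y hx hy].
- rewrite (linear0E (g := fun u => tensor_mul H u v) (ll v)); exact: TensorHomog0.
- rewrite (linearDE (g := fun u => tensor_mul H u v) _ _ (ll v)); exact: TensorHomogD.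
elim: hv => {v} [|v v' _ IH _ IH'|g' x' y' hx' hy'].
- rewrite (linear0E (lr _)); exact: TensorHomog0.
- rewrite (linearDE _ _ (lr _)); exact: TensorHomogD.
rewrite (tensor_mulE bil) HM; apply: (TensorHomogT (g := g + g')).
  exact: (homogM hx hx').
by rewrite opprD; apply: (homogM hy hy').
Qed.

(* The scalars [z g g'] and [z (- g) (- g')] of the inner degrees cancel. *)
Lemma tensor_mul_twist (z : M -> M -> K) (H' : hopf_data U) d d' u v :
    bilinear_map (hmul H') -> (forall g g', z (- g) (- g') = z g g') ->
    (forall g g', z g g' != 0) ->
    (forall d d' x y, hom d x -> hom d' y ->
       hmul H' x y = (z d.1 d'.1 * (z d.2 d'.2)^-1) *: (x * y)) ->
    tensor_homog d u -> tensor_homog d' v ->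
  tensor_mul H' u v = (z d.1 d'.1 * (z d.2 d'.2)^-1) *: tensor_mul H u v.
Proof.
move=> bil' zN z0 H'E.
have [[lr ll] [lr' ll']] := (tensor_mul_bilinear bil, tensor_mul_bilinear bil').
move=> hu hv; elim: hu => {u} [|u u' _ IH _ IH'|g x y hx hy].
- rewrite (linear0E (g := fun u => tensor_mul H u v) (ll v)).
  by rewrite (linear0E (g := fun u => tensor_mul H' u v) (ll' v)) scaler0.
- rewrite (linearDE (g := fun u => tensor_mul H u v) _ _ (ll v)) scalerDr.
  by rewrite (linearDE (g := fun u => tensor_mul H' u v) _ _ (ll' v)) IH IH'.
elim: hv => {v} [|v v' _ IH _ IH'|g' x' y' hx' hy'].
- by rewrite (linear0E (lr _)) (linear0E (lr' _)) scaler0.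
- by rewrite (linearDE _ _ (lr _)) (linearDE _ _ (lr' _)) scalerDr IH IH'.
rewrite (tensor_mulE bil) (tensor_mulE bil') HM.
rewrite (H'E _ _ _ _ hx hx') (H'E _ _ _ _ hy hy') /= zN.
rewrite (linearZE _ _ ((tens_bilinear U U).1 _)).
rewrite (linearZE (g := fun x => tens x _) _ _ ((tens_bilinear U U).2 _)).
rewrite scalerA; apply: (congr1 (fun k => k *: _)).
by field; rewrite !z0.
Qed.

End TensorHomogeneous.

Section Graded.
Variables (K : fieldType) (X : lie_type) (n : nat).
Local Notation N := (dimN X n).
Variables (R : nat -> 'M[K]_(N * N)) (c : 'I_N -> K) (x0 : K) (uni : pred 'I_N).
Local Notation rel := (frtq_rel R c x0 uni).
Local Notation U := (presented rel).
Local Notation deg := (@frt_deg X n).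
Local Notation wd := (wdeg (@frt_deg X n)).
Local Notation wrd w := (ppi rel (fmon K w)).
Variable H : hopf_data U.
Hypothesis HF : is_frt_hopf H.
Local Notation S := (hantipode H).
Let hopfH := frt_hopf HF.
Let HM := frt_mul HF.
Let H1 := frt_one HF.
Let bil := hmul_bilinear hopfH.

Lemma wdeg_gen g w : wd (mmul (fmu g) w) = deg g + wd w.
Proof. by rewrite wdegM; congr (_ + _); rewrite /wdeg fmU big_seq1. Qed.

Lemma wdeg1 : wd mone = 0.
Proof. by rewrite /wdeg fm1 big_nil. Qed.

Lemma homog_gamX b e k : homog deg 0 ((pgen rel (Gam b e)) ^+ k).
Proof. by apply: homogX; exact: (homog_gen rel deg (Gam b e)). Qed.

Lemma comul_gen_homog g : tensor_homog deg (deg g) (hcomul H (pgen rel g)).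
Proof.
have hg h : homog deg (deg h) (pgen rel h) by exact: homog_gen.
have hX := homog_gamX.
case: g => [b [|]|e i j m|e i].
- rewrite (frt_comul_gam HF); apply: (TensorHomogT (g := 0)).
    exact: (hg (Gam b true)).
  by rewrite oppr0; exact: (hg (Gam b true)).
- rewrite (comul_gamV HF); apply: (TensorHomogT (g := 0)).
    exact: (hg (Gam b false)).
  by rewrite oppr0; exact: (hg (Gam b false)).
- case: e; [rewrite (frt_comul_ellP HF)|rewrite (frt_comul_ellN HF)];
    apply: tensor_homog_sum => k _; apply: tensor_homog_sum => a _;
    apply: (TensorHomogT (g := eps k)).
  + rewrite -[(_, _)]addr0; apply: homogM; [exact: (hg (Ell true i k a))|exact: hX].
  + rewrite -[(_, _)]add0r; apply: homogM; [exact: hX|exact: (hg (Ell true k j (m - a)%N))].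
  + rewrite -[(_, _)]addr0; apply: homogM; [exact: (hg (Ell false i k a))|exact: hX].
  + rewrite -[(_, _)]add0r; apply: homogM; [exact: hX|exact: (hg (Ell false k j (m - a)%N))].
- rewrite (comul_ellinv HF); apply: (TensorHomogT (g := - eps i)).
    exact: (hg (EllInv e i)).
  by rewrite opprK; exact: (hg (EllInv e i)).
Qed.

Lemma comul_mul (a b : U) : hcomul H (a * b) = tensor_mul H (hcomul H a) (hcomul H b).
Proof. by have := hcomulM hopfH a b; rewrite HM. Qed.

Lemma comul_one : hcomul H 1 = tens (1 : U) (1 : U).
Proof. by have := hcomul1 hopfH; rewrite H1. Qed.

Lemma comul_word_homog w : tensor_homog deg (wd w) (hcomul H (wrd w)).
Proof.
elim/fmonom_ind: w => [|g w IH].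
  rewrite wdeg1 ppi_word1 comul_one; apply: (TensorHomogT (g := 0)).
    exact: homog1.
  by rewrite oppr0; exact: homog1.
rewrite wdeg_gen ppi_word comul_mul; apply: tensor_homogM => //.
exact: comul_gen_homog.
Qed.

Definition swap_deg (d : 'rV[int]_n * 'rV[int]_n) := (d.2, d.1).

(** Up to central factors of degree zero the antipode of l_ij is a multiple of l_{j'i'}, whose
    bidegree is (- eps_{j'}, eps_{i'}) = (eps_j, - eps_i). *)
Lemma antipode_gen_homog g : (forall i, c i != 0) ->
  homog deg (swap_deg (deg g)) (S (pgen rel g)).
Proof.
move=> c0; have hg h : homog deg (deg h) (pgen rel h) by exact: homog_gen.
case: g => [b [|]|e i j m|e i].
- by rewrite (frt_antipode_gam HF); exact: (hg (Gam b false)).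
- by rewrite (antipode_gamV HF); exact: (hg (Gam b true)).
- rewrite (antipode_ell HF); apply: homogZ.
  rewrite -[swap_deg _]add0r; apply: homogM; first exact: homog_gamX.
  have := hg (Ell e (rev_ord j) (rev_ord i) m).
  by rewrite /= !eps_rev opprK.
rewrite (antipode_ellinv HF) //.
by have := hg (EllInv e (rev_ord i)); rewrite /= eps_rev opprK.
Qed.

Lemma antipode_word_homog w : (forall i, c i != 0) ->
  homog deg (swap_deg (wd w)) (S (wrd w)).
Proof.
move=> c0; elim/fmonom_ind: w => [|g w IH].
  by rewrite wdeg1 ppi_word1 (antipode_frt1 HF); exact: homog1.
rewrite wdeg_gen ppi_word (antipode_frtM HF) addrC.
by apply: (homogM (d := swap_deg (wd w)) (d' := swap_deg (deg g))) => //; exact: antipode_gen_homog.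
Qed.

Lemma counit_gen g : hcounit H (pgen rel g) =
  if g is Ell _ i j m then ((i == j) && (m == 0%N))%:R else 1.
Proof.
case: g => [b [|]|e i j m|e i].
- exact: (frt_counit_gam HF).
- exact: (counit_gamV HF).
- exact: (frt_counit_ell HF).
- exact: (counit_ellinv HF).
Qed.

End Graded.

(** * The isomorphism *)

Section Isomorphism.
Variables (K : fieldType) (X : lie_type) (n : nat).
Local Notation N := (dimN X n).
Variables (z : 'rV[int]_n -> 'rV[int]_n -> K) (psi : 'I_N -> K).
Hypotheses (zB : bicharacter z) (z_alt : forall d, z d d = 1).
Hypothesis psi0 : forall i, psi i != 0.
Variables (R1 R2 : nat -> 'M[K]_(N * N)) (c1 c2 : 'I_N -> K) (x0 : K).
Variable uni : pred 'I_N.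
Hypothesis R12 : forall k i1 i2 j1 j2,
  R1 k (mxtens_index (i1, i2)) (mxtens_index (j1, j2))
  = (psi i1 * psi i2)^-1 * z (eps i2) (eps i1)
    * R2 k (mxtens_index (i1, i2)) (mxtens_index (j1, j2))
    * (psi j1 * psi j2) * (z (eps j1) (eps j2))^-1.
Hypothesis c12 : forall i, c1 i = (psi i)^-1 * (psi (rev_ord i))^-1 * c2 i.
Hypothesis c20 : forall i, c2 i != 0.

Local Notation rel1 := (frtq_rel R1 c1 x0 uni).
Local Notation rel2 := (frtq_rel R2 c2 x0 uni).
Local Notation deg := (@frt_deg X n).
Local Notation wd := (wdeg (@frt_deg X n)).
Local Notation chi := (bidegree_twist z).
Local Notation U1 := (presented rel1).
Local Notation U2 := (presented rel2).
Local Notation wrd1 w := (ppi rel1 (fmon K w)).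
Local Notation wrd2 w := (ppi rel2 (fmon K w)).
Hypothesis hom2 : forall x, rel2 x -> exists d, fhomog deg d x.

Let p := gen_coef psi.
Let wc := word_coef deg chi p.
Let chiB := bidegree_twist_bicharacter zB.
Let wcC : fcocycle deg chi wc := word_coef_cocycle deg p chiB.

Let wc_gen g : wc (fmu g) = p g.
Proof. exact: (word_coef_gen deg p chiB). Qed.

Let wc0 w : wc w != 0.
Proof. exact: (word_coef_neq0 deg chiB (gen_coef_neq0 psi0)). Qed.

Let rel12 x : rel1 x -> ideal_gen rel2 (fdiag wc x).
Proof.
move=> hx.
have [k [y [_ hy ->]]] := fdiag_frtq_rel zB z_alt psi0 wcC wc_gen R12 c12 hx.
exact/ideal_genZ/IdealRel.
Qed.

Let wcV w : wc w * (wc w)^-1 = 1. Proof. exact: (divff (wc0 w)). Qed.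
Let wcVr w : (wc w)^-1 * wc w = 1. Proof. exact: (mulVf (wc0 w)). Qed.

(** Diagonal maps preserve degrees, so homogeneity is pulled back from [rel2]. It makes the inverse
    diagonal map descend to the algebra of [rel1]. *)
Let hom1 x : rel1 x -> exists d, fhomog deg d x.
Proof.
move=> hx.
have [k [y [_ /hom2 [d hd] e]]] := fdiag_frtq_rel zB z_alt psi0 wcC wc_gen R12 c12 hx.
exists d; rewrite -(fdiagK x wcVr) e; exact/fdiag_homog/fhomogZ.
Qed.

Let chiV d d' := (chi d d')^-1.
Let wcI w := (wc w)^-1.
Let wcIC : fcocycle deg chiV wcI := fcocycleV wcC.

(** The situation is symmetric: [fdiag_frtq_rel] applies again with [z] and [psi] inverted and the
    two algebras exchanged. *)
Let rel21 x : rel2 x -> ideal_gen rel1 (fdiag wcI x).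
Proof.
move=> hx; pose z' d d' := (z d d')^-1.
have z'B : bicharacter z'.
  have [hr hl h0] := zB; split=> [d a b|d a b|d d']; rewrite /z'.
  - by rewrite hr invfM.
  - by rewrite (hl d) invfM.
  - by rewrite invr_neq0.
have z'_alt d : z' d d = 1 by rewrite /z' z_alt invr1.
have psi'0 i : (psi i)^-1 != 0 by rewrite invr_neq0.
have C : fcocycle deg (bidegree_twist z') wcI.
  have [w1 wM] := wcIC; split=> // w w'.
  by rewrite wM /chiV /bidegree_twist /z' invfM.
have g' g : wcI (fmu g) = gen_coef (fun i => (psi i)^-1) g.
  rewrite /wcI wc_gen /p; case: g => /= *; rewrite ?invr1 //.
  by rewrite invfM.
have R21 k i1 i2 j1 j2 :
  R2 k (mxtens_index (i1, i2)) (mxtens_index (j1, j2))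
  = ((psi i1)^-1 * (psi i2)^-1)^-1 * z' (eps i2) (eps i1)
    * R1 k (mxtens_index (i1, i2)) (mxtens_index (j1, j2))
    * ((psi j1)^-1 * (psi j2)^-1) * (z' (eps j1) (eps j2))^-1.
  have [_ _ z0] := zB.
  by rewrite R12 /z'; field; rewrite !(psi0, z0, oner_neq0).
have c21 i : c2 i = ((psi i)^-1)^-1 * ((psi (rev_ord i))^-1)^-1 * c1 i.
  by rewrite c12; field; rewrite !(psi0, oner_neq0).
have [k [y [_ hy ->]]] := fdiag_frtq_rel z'B z'_alt psi'0 C g' R21 c21 hx.
exact/ideal_genZ/IdealRel.
Qed.

Definition frt_iso : U1 -> U2 := @pdiag K _ wc rel1 rel2.
Local Notation Psi := frt_iso.

Lemma frt_iso_pi x : Psi (ppi rel1 x) = ppi rel2 (fdiag wc x).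
Proof. exact: (pdiag_pi wcC hom2 rel12). Qed.

Lemma frt_iso_linear : linear Psi.
Proof. exact: (pdiag_linear wcC hom2 rel12). Qed.

Lemma frt_isoM a b : Psi (a * b) = twist_mul deg chi (Psi a) (Psi b).
Proof. exact: (pdiagM wcC hom2 rel12). Qed.

Lemma frt_iso1 : Psi 1 = 1.
Proof. exact: (pdiag1 wcC hom2 rel12). Qed.

Lemma frt_iso_bij : bijective Psi.
Proof.
exists (@pdiag K _ wcI rel2 rel1) => a; rewrite -(ppi_repr a) /frt_iso.
  by rewrite (pdiag_pi wcC hom2 rel12) (pdiag_pi wcIC hom1 rel21) (fdiagK _ wcVr).
by rewrite (pdiag_pi wcIC hom1 rel21) (pdiag_pi wcC hom2 rel12) (fdiagK _ wcV).
Qed.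

Lemma frt_iso_word w : Psi (wrd1 w) = wc w *: wrd2 w.
Proof.
have lp : linear (ppi rel2) by exact: linearP.
by rewrite frt_iso_pi fdiag_mon (linearZE _ _ lp).
Qed.

Lemma frt_iso_gen g : Psi (pgen rel1 g) = p g *: pgen rel2 g.
Proof. by rewrite -wc_gen; exact: (frt_iso_word (fmu g)). Qed.

Lemma frt_iso_eigen d k x : feigen deg wc d k x -> Psi (ppi rel1 x) = k *: ppi rel2 x.
Proof.
have lp : linear (ppi rel2) by exact: linearP.
by move=> [_ e]; rewrite frt_iso_pi e (linearZE _ _ lp).
Qed.

Lemma frt_iso_word_homog w : homog deg (wd w) (Psi (wrd1 w)).
Proof. by rewrite frt_iso_word; apply: homogZ; exact: homog_word. Qed.

Lemma frt_iso_gen_homog g : homog deg (deg g) (Psi (pgen rel1 g)).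
Proof. by rewrite frt_iso_gen; apply: homogZ; exact: homog_gen. Qed.

Variables (H1 : hopf_data U1) (H2 : hopf_data U2).
Hypotheses (HF1 : is_frt_hopf H1) (HF2 : is_frt_hopf H2).

(** For [z = zeta] and the matrices of the theorem this is convertible to [zeta_twist]. *)
Definition twisted_hopf : hopf_data U2 :=
  {| hmul := twist_mul (rel := rel2) deg chi; hone := hone H2; hcomul := hcomul H2;
     hcounit := hcounit H2; hantipode := hantipode H2 |}.
Local Notation HT := twisted_hopf.

Let bil1 := hmul_bilinear (frt_hopf HF1).
Let bil2 := hmul_bilinear (frt_hopf HF2).
Let bilT : bilinear_map (hmul HT).
Proof. exact: (twist_mul_bilinear chi hom2). Qed.

Let twistE d d' (a b : U2) : homog deg d a -> homog deg d' b ->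
  twist_mul deg chi a b = chi d d' *: (a * b).
Proof. exact: (twist_mulE chi hom2). Qed.

Lemma frt_isoM_gen_word g w :
  Psi (pgen rel1 g * wrd1 w) = chi (deg g) (wd w) *: (Psi (pgen rel1 g) * Psi (wrd1 w)).
Proof.
by rewrite frt_isoM; apply: twistE; [exact: frt_iso_gen_homog|exact: frt_iso_word_homog].
Qed.

Let lPsi := frt_iso_linear.

Lemma frt_iso_ell_gamX e i k m b s l :
  Psi (pgen rel1 (Ell e i k m) * pgen rel1 (Gam b s) ^+ l)
  = ((psi i)^-1 * psi k) *: (pgen rel2 (Ell e i k m) * pgen rel2 (Gam b s) ^+ l).
Proof.
have hl := eigen_ell wc_gen e i k m.
have hg := feigenX chiB wcC l (eigen_gam wc_gen b s).
have := frt_iso_eigen (feigenM wcC hl hg).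
have -> : (psi i)^-1 * psi k * 1 * chi (- eps i, eps k) 0 = (psi i)^-1 * psi k.
  by rewrite (bicharacter0r chiB) !mulr1.
by rewrite !ppiM !(rmorphXn (ppi _)).
Qed.

Lemma frt_iso_gamX_ell e i k m b s l :
  Psi (pgen rel1 (Gam b s) ^+ l * pgen rel1 (Ell e i k m))
  = ((psi i)^-1 * psi k) *: (pgen rel2 (Gam b s) ^+ l * pgen rel2 (Ell e i k m)).
Proof.
have hl := eigen_ell wc_gen e i k m.
have hg := feigenX chiB wcC l (eigen_gam wc_gen b s).
have := frt_iso_eigen (feigenM wcC hg hl).
have -> : 1 * ((psi i)^-1 * psi k) * chi 0 (- eps i, eps k) = (psi i)^-1 * psi k.
  by rewrite (bicharacter0l chiB) mulr1 mul1r.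
by rewrite !ppiM !(rmorphXn (ppi _)).
Qed.

Lemma frt_iso_gam b e : Psi (pgen rel1 (Gam b e)) = pgen rel2 (Gam b e).
Proof. by rewrite frt_iso_gen scale1r. Qed.

Lemma frt_iso_ellinv e i : Psi (pgen rel1 (EllInv e i)) = pgen rel2 (EllInv e i).
Proof. by rewrite frt_iso_gen scale1r. Qed.

Let tensZ k l (x y : U2) : tens (k *: x) (l *: y) = (k * l) *: tens x y.
Proof.
rewrite (linearZE _ _ ((tens_bilinear U2 U2).1 _)).
rewrite (linearZE (g := fun x => tens x y) _ _ ((tens_bilinear U2 U2).2 _)).
by rewrite scalerA mulrC.
Qed.

Let lPsi2 : linear (tensor_map Psi Psi).
Proof. exact: tensor_map_linear. Qed.
Let lD2 := hcomul_linear (frt_hopf HF2).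

Lemma frt_iso_comul_gen g :
  hcomul H2 (Psi (pgen rel1 g)) = tensor_map Psi Psi (hcomul H1 (pgen rel1 g)).
Proof.
have map_ell e i k j a m b l l' :
    tensor_map Psi Psi (tens (pgen rel1 (Ell e i k a) * pgen rel1 (Gam b true) ^+ l)
                             (pgen rel1 (Gam b true) ^+ l' * pgen rel1 (Ell e k j m)))
    = ((psi i)^-1 * psi j) *:
      tens (pgen rel2 (Ell e i k a) * pgen rel2 (Gam b true) ^+ l)
           (pgen rel2 (Gam b true) ^+ l' * pgen rel2 (Ell e k j m)).
  rewrite (tensor_mapE _ _ lPsi lPsi).
  apply: etrans (congr2 (@tens K U2 U2) (frt_iso_ell_gamX e i k a b true l)
    (frt_iso_gamX_ell e k j m b true l')) _.
  rewrite [LHS]tensZ.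
  (* The inner index k drops out, so the whole coproduct is scaled by the factor of l_ij. *)
  have -> : (psi i)^-1 * psi k * ((psi k)^-1 * psi j) = (psi i)^-1 * psi j.
    by field; rewrite !psi0.
  reflexivity.
case: g => [b [|]|e i j m|e i].
- rewrite frt_iso_gam (frt_comul_gam HF1) (frt_comul_gam HF2).
  by rewrite (tensor_mapE _ _ lPsi lPsi) frt_iso_gam.
- rewrite frt_iso_gam (comul_gamV HF1) (comul_gamV HF2).
  by rewrite (tensor_mapE _ _ lPsi lPsi) frt_iso_gam.
- rewrite frt_iso_gen (linearZE _ _ lD2).
  case: e; [rewrite (frt_comul_ellP HF1) (frt_comul_ellP HF2)
           |rewrite (frt_comul_ellN HF1) (frt_comul_ellN HF2)];
    rewrite (linear_sumE _ _ _ lPsi2) scaler_sumr; apply: eq_bigr => k _;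
    rewrite (linear_sumE _ _ _ lPsi2) scaler_sumr; apply: eq_bigr => a _;
    exact/esym/map_ell.
- rewrite frt_iso_ellinv (comul_ellinv HF1) (comul_ellinv HF2).
  by rewrite (tensor_mapE _ _ lPsi lPsi) frt_iso_ellinv.
Qed.

Lemma frt_iso_comul a : hcomul H2 (Psi a) = tensor_map Psi Psi (hcomul H1 a).
Proof.
move: a; apply: presented_word_ext => [||w].
- exact: linear_comp lD2 lPsi.
- exact: linear_comp lPsi2 (hcomul_linear (frt_hopf HF1)).
elim/fmonom_ind: w => [|g w IH].
  rewrite ppi_word1 frt_iso1 (comul_one HF1) (comul_one HF2).
  by rewrite (tensor_mapE _ _ lPsi lPsi) frt_iso1.
rewrite ppi_word frt_isoM_gen_word (linearZE _ _ lD2) (comul_mul HF1) (comul_mul HF2).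
rewrite (tensor_mapM _ _ bil1 bilT lPsi); last first.
  by move=> u v; rewrite (frt_mul HF1); exact: frt_isoM.
rewrite -IH -frt_iso_comul_gen.
have [_ _ z0] := zB.
(* The twisted product of the two coproducts differs from the ordinary one by chi of the outer
   degrees, the same scalar that [Psi] produces on the product of [g] and [w]. *)
apply/esym; apply: (tensor_mul_twist (frt_mul HF2) bil2 bilT) => //.
- by move=> d d'; rewrite (bicharacterNl zB) (bicharacterNr zB) invrK.
- by move=> d d' x y; exact: twistE.
- rewrite frt_iso_gen (linearZE _ _ lD2); apply: tensor_homogZ.
  exact: comul_gen_homog.
- rewrite frt_iso_word (linearZE _ _ lD2); apply: tensor_homogZ.
  exact: comul_word_homog.
Qed.

(** [Psi] scales a word by [wc w], which must be 1 wherever the counit is nonzero. The degree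
    condition is the induction invariant: letters with nonzero counit have bidegree (- d, d), and
    chi is 1 between two such bidegrees. *)
Lemma counit_word w :
  hcounit H2 (wrd2 w) = hcounit H1 (wrd1 w) /\
  (hcounit H1 (wrd1 w) != 0 -> wc w = 1 /\ (wd w).1 + (wd w).2 = 0).
Proof.
elim/fmonom_ind: w => [|g w [IH1 IH2]].
  rewrite !ppi_word1 (counit_frt1 HF1) (counit_frt1 HF2) wdeg1.
  by split=> // _; split; [case: wcC|rewrite addr0].
rewrite !ppi_word (counit_frtM HF1) (counit_frtM HF2) IH1.
rewrite (counit_gen HF1) (counit_gen HF2); split=> //.
rewrite mulf_eq0 negb_or => /andP[hg /IH2 [hw dw]].
have [pg dg] : p g = 1 /\ (deg g).1 + (deg g).2 = 0.
  case: g hg => [b e|e i j m|e i] /=.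
  - by rewrite addr0.
  - by have [-> _|_] := eqVneq i j; rewrite /= ?eqxx // mulVf // addNr.
  - by rewrite addrN.
rewrite wdeg_gen; split; last first.
  rewrite -[_.1]/(_ + _) -[_.2]/(_ + _).
  by rewrite addrACA dg dw addr0.
have [_ wM] := wcC; rewrite wM wc_gen pg hw !mul1r /wdeg fmU big_seq1 -/(wdeg _ _) /bidegree_twist.
have -> : (deg g).1 = - (deg g).2 by apply/eqP; rewrite -addr_eq0 dg.
have -> : (wd w).1 = - (wd w).2 by apply/eqP; rewrite -addr_eq0 dw.
have [_ _ z0] := zB.
by rewrite (bicharacterNl zB) (bicharacterNr zB) invrK divff.
Qed.

Lemma frt_iso_counit a : hcounit H2 (Psi a) = hcounit H1 a.
Proof.
have l1 : linear (hcounit H1 : U1 -> K^o) by move=> k x y; exact: (hcounit_linear (frt_hopf HF1)).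
have l2 : linear (hcounit H2 : U2 -> K^o) by move=> k x y; exact: (hcounit_linear (frt_hopf HF2)).
move: a; apply: (presented_word_ext (V := K^o)) => [||w] //.
  exact: (linear_comp (W := K^o) l2 lPsi).
have [e1 e2] := counit_word w.
rewrite frt_iso_word (linearZE _ _ l2) e1.
have [->|/e2 [-> _]] := eqVneq (hcounit H1 (wrd1 w)) 0; first by rewrite scaler0.
by rewrite scale1r.
Qed.

Let lS1 := hantipode_linear (frt_hopf HF1).
Let lS2 := hantipode_linear (frt_hopf HF2).

Let c10 i : c1 i != 0.
Proof. by rewrite c12 mulf_neq0 // mulf_neq0 // invr_neq0. Qed.

Lemma frt_iso_antipode_gen g :
  hantipode H2 (Psi (pgen rel1 g)) = Psi (hantipode H1 (pgen rel1 g)).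
Proof.
case: g => [b [|]|e i j m|e i].
- by rewrite (frt_antipode_gam HF1) !frt_iso_gam (frt_antipode_gam HF2).
- by rewrite (antipode_gamV HF1) !frt_iso_gam (antipode_gamV HF2).
- rewrite frt_iso_gen (linearZE _ _ lS2) (antipode_ell HF1) (antipode_ell HF2).
  rewrite (linearZE _ _ lPsi) (frt_iso_gamX_ell e (rev_ord j) (rev_ord i) m e false).
  rewrite [LHS]scalerA [RHS]scalerA; apply: (congr1 (fun k => k *: _)).
  rewrite !c12 /=; set Q := x0 ^ _.
  by field; rewrite !(psi0, c20, oner_neq0).
- by rewrite (antipode_ellinv HF1 _ (c10 i)) !frt_iso_ellinv (antipode_ellinv HF2).
Qed.

Lemma frt_iso_antipode a : hantipode H2 (Psi a) = Psi (hantipode H1 a).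
Proof.
move: a; apply: presented_word_ext => [||w].
- exact: linear_comp lS2 lPsi.
- exact: linear_comp lPsi lS1.
elim/fmonom_ind: w => [|g w IH].
  by rewrite ppi_word1 frt_iso1 (antipode_frt1 HF1) (antipode_frt1 HF2) frt_iso1.
rewrite ppi_word frt_isoM_gen_word (linearZE _ _ lS2) (antipode_frtM HF1).
rewrite (antipode_frtM HF2) frt_isoM -IH -frt_iso_antipode_gen.
have hg : homog deg (swap_deg (deg g)) (hantipode H2 (Psi (pgen rel1 g))).
  rewrite frt_iso_gen (linearZE _ _ lS2); apply: homogZ.
  exact: antipode_gen_homog.
have hw : homog deg (swap_deg (wd w)) (hantipode H2 (Psi (wrd1 w))).
  rewrite frt_iso_word (linearZE _ _ lS2); apply: homogZ.
  exact: antipode_word_homog.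
rewrite (twistE hw hg); apply: (congr1 (fun k => k *: _)).
(* Reversing the factors inverts chi because [z] is alternating, and swapping the two degrees
   inverts it again, so the scalars agree. *)
rewrite /bidegree_twist /swap_deg /= (alternating_sym zB z_alt (deg g).2).
by rewrite (alternating_sym zB z_alt (deg g).1) invrK mulrC.
Qed.

Lemma frt_iso_hopf : is_hopf_iso H1 HT Psi.
Proof.
split.
- exact: frt_iso_linear.
- exact: frt_iso_bij.
- by move=> a b; rewrite (frt_mul HF1); exact: frt_isoM.
- by rewrite (frt_one HF1) /= (frt_one HF2) frt_iso1.
- exact: frt_iso_comul.
- exact: frt_iso_counit.
- exact: frt_iso_antipode.
Qed.

Lemma frt_iso_unique (Phi : U1 -> U2) : is_hopf_iso H1 HT Phi ->
    (forall b, Phi (pgen rel1 (Gam b true)) = pgen rel2 (Gam b true)) ->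
    (forall e i j m, Phi (pgen rel1 (Ell e i j m))
       = ((psi i)^-1 * psi j) *: pgen rel2 (Ell e i j m)) ->
  Psi =1 Phi.
Proof.
move=> hPhi Phi_gam Phi_ell.
have PhiM a b : Phi (a * b) = twist_mul deg chi (Phi a) (Phi b).
  by have := hisoM hPhi a b; rewrite (frt_mul HF1).
have Phi1 : Phi 1 = 1.
  by have := hiso1 hPhi; rewrite (frt_one HF1) /= (frt_one HF2).
(* [Phi] is not prescribed on the inverse generators. Inverses are compared in [U1] after applying
   the inverse [Q] of [Psi], so that only associativity of the untwisted product is used. *)
have PhiV x y : x * y = 1 -> y * x = 1 -> Psi x = Phi x -> Psi y = Phi y.
  move=> xy yx e; have [Q PQ QP] := frt_iso_bij.
  suff yE : y = Q (Phi y) by rewrite [in LHS]yE QP.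
  rewrite -[LHS]mul1r; have <- : Q (Phi y) * x = 1.
    apply: (can_inj PQ).
    by rewrite frt_isoM QP e -PhiM yx Phi1 frt_iso1.
  by rewrite -mulrA xy mulr1.
have gen_eq g : Psi (pgen rel1 g) = Phi (pgen rel1 g).
  case: g => [b [|]|e i j m|e i].
  - by rewrite Phi_gam frt_iso_gam.
  - apply: PhiV (gamV _ _ _ _ b) (gamVr _ _ _ _ b) _.
    by rewrite Phi_gam frt_iso_gam.
  - by rewrite Phi_ell frt_iso_gen.
  - apply: PhiV (ellV _ _ _ _ e i) (ellVr _ _ _ _ e i) _.
    by rewrite Phi_ell frt_iso_gen.
apply: presented_word_ext => [||w]; [exact: lPsi|exact: hiso_linear hPhi|].
elim/fmonom_ind: w => [|g w IH]; first by rewrite ppi_word1 Phi1 frt_iso1.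
by rewrite ppi_word frt_isoM PhiM gen_eq IH.
Qed.

End Isomorphism.

(** * Invertibility of the parameters and specialisation to [zeta] *)

Lemma transcendental_neq0 (K : fieldType) (x : K) : transcendental x -> x != 0.
Proof.
move=> tx; apply/eqP => x0; have := tx 'X.
by rewrite map_polyX polyX_eq0 /= => /(_ isT); rewrite x0 /root hornerX eqxx.
Qed.

Lemma root_neq0 (K : fieldType) (x : K) rt m : compatible_roots x rt ->
  x != 0 -> (0 < m)%N -> rt m != 0.
Proof.
move=> [rt1 rtM] x0 m0; apply: contraNneq x0 => rm0.
by rewrite -rt1 -(rtM m 1%N m0 isT) muln1 rm0 expr0n eqn0Ngt m0.
Qed.

Lemma cq_neq0 (K : fieldType) X n (rr sr : nat -> K) (i : 'I_(dimN X n)) :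
  q rr sr != 0 -> cq rr sr i != 0.
Proof.
move=> q0; rewrite mulf_neq0 ?expfz_neq0 //.
by move: i; case: X => i; rewrite /sigma; do ?case: ifP => _; rewrite ?oppr_eq0 oner_neq0.
Qed.

Theorem proposition8p6 (K : closedFieldType) (r s : K) (rr sr : nat -> K)
    (X : lie_type) (n : nat) (f : nat -> K)
    (r_transc : transcendental r) (s_transc : transcendental s)
    (rs_not_root1 : forall m : nat, (0 < m)%N -> (r / s) ^+ m != 1)
    (r_roots : compatible_roots r rr) (s_roots : compatible_roots s sr)
    (n_ok : rank_ok X n)
    (f_norm : is_normalization X n rr sr f)
    (Hrs : hopf_data (Ut_rs X n rr sr f)) (Hq : hopf_data (Ut_q X n rr sr f))
    (Hrs_frt : is_frt_hopf Hrs) (Hq_frt : is_frt_hopf Hq) :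
  exists! Psi : Ut_rs X n rr sr f -> Ut_q X n rr sr f,
    [/\ is_hopf_iso Hrs (zeta_twist Hq) Psi,
        forall b : bool,
          Psi (pgen (rel_rs rr sr f) (Gam b true))
          = pgen (rel_q rr sr f) (Gam b true)
      & forall (e : bool) (i j : 'I_(dimN X n)) (m : nat),
          Psi (pgen (rel_rs rr sr f) (Ell e i j m))
          = ((psi rr sr i)^-1 * psi rr sr j) *:
              (pgen (rel_q rr sr f) (Ell e i j m) : Ut_q X n rr sr f)].
Proof.
(* Nonzero roots of r and s make [kappa], the [psi] and [q] invertible, as needed for the
   bicharacter and for the diagonal matrices. *)
have rr0 m : (0 < m)%N -> rr m != 0.
  exact: root_neq0 r_roots (transcendental_neq0 r_transc).
have sr0 m : (0 < m)%N -> sr m != 0.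
  exact: root_neq0 s_roots (transcendental_neq0 s_transc).
have rs2 : rs_root rr sr 2 != 0 by rewrite mulf_neq0 ?rr0 ?sr0.
have rs4 : rs_root rr sr 4 != 0 by rewrite mulf_neq0 ?rr0 ?sr0.
have q0 : q rr sr != 0 by rewrite mulf_neq0 ?invr_neq0 ?rr0 ?sr0.
have zB := zeta_bicharacter X n rs2 rs4.
have zA := @zeta_diag K X n rr sr.
have p0 := @psi_neq0 K X n rr sr rs2 rs4.
have RE := @R_tilde_rsE K X n rr sr rs2 rs4 f.
have cE (i : 'I_(dimN X n)) :
  crs rr sr i = (psi rr sr i)^-1 * (psi rr sr (rev_ord i))^-1 * cq rr sr i by [].
have c0 (i : 'I_(dimN X n)) : cq rr sr i != 0 by exact: cq_neq0.
have hom := @rel_q_homog K X n rr sr f.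
pose Psi := @frt_iso K X n (zeta X rr sr) (psi rr sr)
  (R_tilde rr sr f (Rhat_rs X n rr sr)) (R_tilde rr sr f (Rhat_q X n rr sr))
  (crs rr sr) (cq rr sr) (xi X n rr sr) (@unimod X n).
exists Psi; split.
  split.
  - exact: (frt_iso_hopf zB zA p0 RE cE c0 hom Hrs_frt Hq_frt).
  - move=> b; exact: (frt_iso_gam zB zA p0 RE cE hom b true).
  - move=> e i j m; exact: (frt_iso_gen zB zA p0 RE cE hom (Ell e i j m)).
move=> Phi [hPhi gPhi ePhi]; apply: funext => a.
exact: (frt_iso_unique zB zA p0 RE cE hom Hrs_frt Hq_frt hPhi gPhi ePhi a).
Qed.
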